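(* Let $K$ be a field and let $A=K[x_1,x_2,x_3;Q,\mathbb{A},\mathbb{B}]$ be a bi-quadratic algebra on 3 generators with $q_1\ne 1$, $q_2=q_3=1$. 1. If $\mu+\alpha\ne 0$ then (up to $G_3$): $$x_2x_1=q_1x_1x_2,\quad x_3x_1=x_1(x_3+\alpha),\quad x_3x_2=x_2(x_3+\mu)$$ where $(\alpha,\mu)\in\{(1,\mu'),(0,1)\mid \mu'\in K\setminus\{-1\}\}$. The elements $x_1$ and $x_2$ are regular normal elements of $A$. The algebra $A=K[x_3][x_2,x_1;\sigma,\tau,b=0,\rho=q_1]$ is a diskew polynomial algebra where $\tau(x_3)=x_3-\alpha$ and $\sigma(x_3)=x_3-\mu$. Furthermore, the algebra $A=\mathcal{D}[x_2,x_1;\sigma,\tau,a=h]$ is a generalized Weyl algebra where $\mathcal{D}=K[x_3][h;\tau\sigma]$ is a skew polynomial ring where $\tau\sigma(x_3)=x_3-\alpha-\mu$, $\sigma(h)=q_1h$ and $\tau(h)=q_1^{-1}h$. The element $h$ is a regular normal element of $A$. Moreover: (a) The algebra $A=K[x_3][x_1;\sigma_1][x_2;\sigma_2]$ is an iterated skew polynomial algebra where $\sigma_1(x_3)=x_3-\alpha$, $\sigma_2(x_3)=x_3-\mu$ and $\sigma_2(x_1)=q_1x_1$. (b) The algebra homomorphism $A(q_1,\alpha=1,\mu=0)\to A(q_1^{-1},\alpha=0,\mu=1)$, $x_1\mapsto x_2$, $x_2\mapsto x_1$, $x_3\mapsto x_3$, is an algebra isomorphism. (c) In particular, the algebra homomorphism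 $A(q_1=-1,\alpha=1,\mu=0)\to A(q_1=-1,\alpha=0,\mu=1)$, $x_1\mapsto x_2$, $x_2\mapsto x_1$, $x_3\mapsto x_3$, is an algebra isomorphism. 2. If $\mu+\alpha=0$ then (up to $G_3$): $$x_2x_1=q_1x_1x_2+cx_3+b_1,\quad x_3x_1=x_1(x_3+\alpha),\quad x_3x_2=x_2(x_3-\alpha)$$ where exactly one of the following cases occurs: (a) $\alpha=0$ and $c,b_1\in\{0,1\}$, (b) $\alpha=1$ and $(c,b_1)\in\{(0,0),(1,1)\}$, (c) $\alpha=1$, $c=0$, $b_1=1$, or $\alpha=1$, $c=1$, $b_1\in K\setminus\{1\}$. So the cases (a)–(c) can be written as $(\alpha,c,b_1)\in\{0,1\}^3$ or $\alpha=1$, $c=1$, $b_1\in K\setminus\{0,1\}$. The algebra $A=K[x_3][x_2,x_1;\sigma,\sigma^{-1},b=cx_3+b_1,\rho=q_1]$ is a diskew polynomial algebra where $\sigma(x_3)=x_3+\alpha$. Furthermore, the algebra $A=K[x_3,h][x_2,x_1;\sigma,a=h]$ is a classical generalized Weyl algebra where $\sigma(x_3)=x_3+\alpha$ and $\sigma(h)=q_1h+cx_3+b_1$.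
   Context: Let $K$ be a field, $K^\times=K\setminus\{0\}$. A bi-quadratic algebra on 3 generators $A=K[x_1,x_2,x_3;Q,\mathbb{A},\mathbb{B}]$ is the $K$-algebra generated by $x_1,x_2,x_3$ subject to the defining relations $x_2x_1-q_1x_1x_2=ax_1+bx_2+cx_3+b_1$, $x_3x_1-q_2x_1x_3=\alpha x_1+\beta x_2+\gamma x_3+b_2$, $x_3x_2-q_3x_2x_3=\lambda x_1+\mu x_2+\nu x_3+b_3$, where $Q=(q_1,q_2,q_3)\in (K^\times)^3$, $\mathbb{A}=\begin{pmatrix}a&b&c\\ \alpha&\beta&\gamma\\ \lambda&\mu&\nu\end{pmatrix}$ has entries in $K$, $\mathbb{B}=(b_1,b_2,b_3)\in K^3$; it is always assumed that the monomials $x_1^ix_2^jx_3^k$ ($i,j,k\ge0$) form a $K$-basis of $A$ (PBW basis). $G_3$ is the group of affine changes of generators $x_i\mapsto\lambda_ix_i+\mu_i$ ($\lambda_i\in K^\times$, $\mu_i\in K$, $i=1,2,3$). ''Up to $G_3$'' means: after such a change of the canonical generators, the new canonical generators (again denoted $x_1,x_2,x_3$) have the displayed defining relations (with new parameters denoted by the same letters). $A(q_1,\alpha,\mu)$ denotes the algebra with the defining relations displayed in statement 1 for the given values of parameters. An element of a ring $R$ is regular if it is neither a left nor a right zero-divisor; $r\in R$ is normal if $Rr=rR$. A skew polynomial ring $D[h;\nu]$ has relations $hd=\nu(d)h$ for $d\in D$. Diskew polynomial ring: for a ring $D$, ring endomorphisms $\sigma,\tau$ of $D$ and $\rho,b\in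 D$ with $\sigma\tau(d)\rho=\rho\tau\sigma(d)$ and $\sigma\tau(d)b=bd$ for all $d\in D$, the ring $D[x,y;\sigma,\tau,b,\rho]$ is generated by $D,x,y$ subject to $xd=\sigma(d)x$, $yd=\tau(d)y$ ($d\in D$), $xy-\rho yx=b$. Generalized Weyl algebra (GWA): for a ring $D$, ring endomorphisms $\sigma,\tau$ and $a\in D$ with $\tau\sigma(a)=a$, $ad=\tau\sigma(d)a$, $\sigma(a)d=\sigma\tau(d)\sigma(a)$ for all $d\in D$, the ring $D[x,y;\sigma,\tau,a]$ is generated by $D,x,y$ subject to $xd=\sigma(d)x$, $yd=\tau(d)y$ ($d\in D$), $yx=a$, $xy=\sigma(a)$. If $\sigma$ is an automorphism, $\tau=\sigma^{-1}$ and $a$ is central in $D$, it is called a classical GWA and denoted $D[x,y;\sigma,a]$. In the present theorem the roles of $x,y$ are played by $x_2,x_1$, so $h=x_1x_2$. *)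

(* Defs.v *)
From HB Require Import structures.
From mathcomp Require Import all_boot all_algebra.
From mathcomp Require Import boolp.
Set Implicit Arguments.
Unset Strict Implicit.
Unset Printing Implicit Defensive.
Import GRing.Theory.
Local Open Scope ring_scope.
Local Open Scope quotient_scope.

(* Rings by generators and relations over a base ring: [pres E] is the ring   *)
(* generated by (a homomorphic image of) the ring D and the family I, subject *)
(* to s = t whenever [E s t]. It is the set of formal ring expressions        *)
(* modulo the least ring congruence that contains E and makes D -> pres E     *)
(* a ring morphism. It may be trivial, hence only a pzRingType.               *)

Inductive rterm (D I : Type) : Type :=
| TCst of D
| TGen of I
| TAdd of rterm D I & rterm D I
| TOpp of rterm D I
| TMul of rterm D I & rterm D I.
Arguments TCst {D I} _.
Arguments TGen {D I} _.

Declare Scope rterm_scope.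
Delimit Scope rterm_scope with RT.
Bind Scope rterm_scope with rterm.
Notation "s + t" := (TAdd s t) : rterm_scope.
Notation "- t" := (TOpp t) : rterm_scope.
Notation "s - t" := (TAdd s (TOpp t)) : rterm_scope.
Notation "s * t" := (TMul s t) : rterm_scope.

Inductive rcong (D : pzRingType) (I : Type)
    (E : rterm D I -> rterm D I -> Prop) : rterm D I -> rterm D I -> Prop :=
| rc_rel s t : E s t -> rcong E s t
| rc_refl s : rcong E s s
| rc_sym s t : rcong E s t -> rcong E t s
| rc_trans s t u : rcong E s t -> rcong E t u -> rcong E s u
| rc_add s s' t t' :
    rcong E s s' -> rcong E t t' -> rcong E (s + t)%RT (s' + t')%RT
| rc_opp s s' : rcong E s s' -> rcong E (- s)%RT (- s')%RT
| rc_mul s s' t t' :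
    rcong E s s' -> rcong E t t' -> rcong E (s * t)%RT (s' * t')%RT
| rc_cstD d e : rcong E (TCst (d + e)) (TCst d + TCst e)%RT
| rc_cstM d e : rcong E (TCst (d * e)) (TCst d * TCst e)%RT
| rc_addA s t u : rcong E (s + (t + u))%RT (s + t + u)%RT
| rc_addC s t : rcong E (s + t)%RT (t + s)%RT
| rc_add0 s : rcong E (TCst 0 + s)%RT s
| rc_addN s : rcong E (- s + s)%RT (TCst 0)
| rc_mulA s t u : rcong E (s * (t * u))%RT (s * t * u)%RT
| rc_mul1 s : rcong E (TCst 1 * s)%RT s
| rc_mulr1 s : rcong E (s * TCst 1)%RT s
| rc_mulDl s t u : rcong E ((s + t) * u)%RT (s * u + t * u)%RT
| rc_mulDr s t u : rcong E (s * (t + u))%RT (s * t + s * u)%RT.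

HB.instance Definition _ (D I : Type) := gen_eqMixin (rterm D I).
HB.instance Definition _ (D I : Type) := gen_choiceMixin (rterm D I).

Section Presentation.
Variables (D : pzRingType) (I : Type) (E : rterm D I -> rterm D I -> Prop).

Definition rcongb : rel (rterm D I) := fun s t => `[< rcong E s t >].

Lemma rcongb_equiv : equiv_class_of rcongb.
Proof.
split=> [s|s t|t s u].
- exact/asboolP/rc_refl.
- by apply/asboolP/asboolP => /rc_sym.
- by move=> /asboolP st /asboolP tu; apply/asboolP/rc_trans/tu.
Qed.

Canonical rcongb_rel := EquivRelPack rcongb_equiv.

Definition pres := {eq_quot rcongb_rel}.
HB.instance Definition _ := Choice.on pres.
HB.instance Definition _ := EqQuotient.on pres.

Definition pcst (d : D) : pres := \pi_pres (TCst d).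
Definition pgen (i : I) : pres := \pi_pres (TGen i).
Definition pres_add (x y : pres) : pres := \pi_pres (repr x + repr y)%RT.
Definition pres_opp (x : pres) : pres := \pi_pres (- repr x)%RT.
Definition pres_mul (x y : pres) : pres := \pi_pres (repr x * repr y)%RT.

Lemma pres_eqP s t : \pi_pres s = \pi_pres t <-> rcong E s t.
Proof.
by split=> [/eqmodP/asboolP // | st]; apply/eqmodP/asboolP.
Qed.

Lemma repr_piP s : rcong E (repr (\pi_pres s)) s.
Proof. by apply/pres_eqP; rewrite reprK. Qed.

Lemma pres_piD s t : pres_add (\pi_pres s) (\pi_pres t) = \pi_pres (s + t)%RT.
Proof. by apply/pres_eqP/rc_add; exact: repr_piP. Qed.
Lemma pres_piN s : pres_opp (\pi_pres s) = \pi_pres (- s)%RT.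
Proof. by apply/pres_eqP/rc_opp; exact: repr_piP. Qed.
Lemma pres_piM s t : pres_mul (\pi_pres s) (\pi_pres t) = \pi_pres (s * t)%RT.
Proof. by apply/pres_eqP/rc_mul; exact: repr_piP. Qed.

Lemma presW (P : pres -> Prop) : (forall s, P (\pi_pres s)) -> forall x, P x.
Proof. by move=> h x; rewrite -(reprK x). Qed.

Fact pres_addA : associative pres_add.
Proof.
by elim/presW=> s; elim/presW=> t; elim/presW=> u;
  rewrite !pres_piD; apply/pres_eqP/rc_addA.
Qed.
Fact pres_addC : commutative pres_add.
Proof.
by elim/presW=> s; elim/presW=> t; rewrite !pres_piD; apply/pres_eqP/rc_addC.
Qed.
Fact pres_add0 : left_id (pcst 0) pres_add.
Proof. by elim/presW=> s; rewrite !pres_piD; apply/pres_eqP/rc_add0. Qed.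
Fact pres_addN : left_inverse (pcst 0) pres_opp pres_add.
Proof.
by elim/presW=> s; rewrite pres_piN pres_piD; apply/pres_eqP/rc_addN.
Qed.
Fact pres_mulA : associative pres_mul.
Proof.
by elim/presW=> s; elim/presW=> t; elim/presW=> u;
  rewrite !pres_piM; apply/pres_eqP/rc_mulA.
Qed.
Fact pres_mul1 : left_id (pcst 1) pres_mul.
Proof. by elim/presW=> s; rewrite !pres_piM; apply/pres_eqP/rc_mul1. Qed.
Fact pres_mulr1 : right_id (pcst 1) pres_mul.
Proof. by elim/presW=> s; rewrite !pres_piM; apply/pres_eqP/rc_mulr1. Qed.
Fact pres_mulDl : left_distributive pres_mul pres_add.
Proof.
by elim/presW=> s; elim/presW=> t; elim/presW=> u;
  rewrite !(pres_piD, pres_piM); apply/pres_eqP/rc_mulDl.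
Qed.
Fact pres_mulDr : right_distributive pres_mul pres_add.
Proof.
by elim/presW=> s; elim/presW=> t; elim/presW=> u;
  rewrite !(pres_piD, pres_piM); apply/pres_eqP/rc_mulDr.
Qed.

HB.instance Definition _ := GRing.isZmodule.Build pres
  pres_addA pres_addC pres_add0 pres_addN.
HB.instance Definition _ := GRing.Zmodule_isPzRing.Build pres
  pres_mulA pres_mul1 pres_mulr1 pres_mulDl pres_mulDr.

Lemma cst_is_zmod : zmod_morphism pcst.
Proof.
have cD d e : pcst (d + e) = pcst d + pcst e.
  rewrite [RHS]pres_piD; exact/pres_eqP/rc_cstD.
by move=> d e; apply/(canRL (addrK _)); rewrite -cD subrK.
Qed.
Lemma cst_is_monoid : monoid_morphism pcst.
Proof. by split=> // d e; rewrite [RHS]pres_piM; apply/pres_eqP/rc_cstM. Qed.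

HB.instance Definition _ := GRing.isZmodMorphism.Build D pres pcst cst_is_zmod.
HB.instance Definition _ := GRing.isMonoidMorphism.Build D pres pcst
  cst_is_monoid.

End Presentation.

Arguments pcst {D I E} d.
Arguments pgen {D I E} i.

Variant xy := gX | gY.

Section SkewConstructions.
Variable D : pzRingType.

Inductive skew_rel (nu : {rmorphism D -> D}) :
    rterm D unit -> rterm D unit -> Prop :=
| skew_h d : skew_rel nu (TGen tt * TCst d)%RT (TCst (nu d) * TGen tt)%RT.

Definition skew_poly nu := pres (skew_rel nu).
HB.instance Definition _ nu := GRing.PzRing.on (skew_poly nu).

Inductive diskew_rel (sigma tau : {rmorphism D -> D}) (b rho : D) :
    rterm D xy -> rterm D xy -> Prop :=
| diskew_x d :
    diskew_rel sigma tau b rho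
      (TGen gX * TCst d)%RT (TCst (sigma d) * TGen gX)%RT
| diskew_y d :
    diskew_rel sigma tau b rho
      (TGen gY * TCst d)%RT (TCst (tau d) * TGen gY)%RT
| diskew_xy :
    diskew_rel sigma tau b rho
      (TGen gX * TGen gY - TCst rho * TGen gY * TGen gX)%RT (TCst b).

Definition diskew sigma tau b rho := pres (diskew_rel sigma tau b rho).
HB.instance Definition _ sigma tau b rho :=
  GRing.PzRing.on (diskew sigma tau b rho).

Definition diskew_data (sigma tau : {rmorphism D -> D}) (b rho : D) : Prop :=
  forall d, sigma (tau d) * rho = rho * tau (sigma d)
         /\ sigma (tau d) * b = b * d.

Inductive gwa_rel (sigma tau : {rmorphism D -> D}) (a : D) :
    rterm D xy -> rterm D xy -> Prop :=
| gwa_x d :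
    gwa_rel sigma tau a (TGen gX * TCst d)%RT (TCst (sigma d) * TGen gX)%RT
| gwa_y d :
    gwa_rel sigma tau a (TGen gY * TCst d)%RT (TCst (tau d) * TGen gY)%RT
| gwa_yx : gwa_rel sigma tau a (TGen gY * TGen gX)%RT (TCst a)
| gwa_xy : gwa_rel sigma tau a (TGen gX * TGen gY)%RT (TCst (sigma a)).

Definition gwa sigma tau a := pres (gwa_rel sigma tau a).
HB.instance Definition _ sigma tau a := GRing.PzRing.on (gwa sigma tau a).

Definition gwa_data (sigma tau : {rmorphism D -> D}) (a : D) : Prop :=
  tau (sigma a) = a /\
  forall d, a * d = tau (sigma d) * a
         /\ sigma a * d = sigma (tau d) * sigma a.

Variable R : pzRingType.

(* "R = D[h; nu]", "R = D[x, y; sigma, tau, b, rho]", etc.: the isomorphism   *)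
(* is prescribed on D (by j) and on the canonical generators.                 *)

Definition is_skew_poly (nu : {rmorphism D -> D}) (j : D -> R) (h : R) : Prop :=
  exists f : {rmorphism skew_poly nu -> R},
    [/\ bijective f, forall d, f (pcst d) = j d & f (pgen tt) = h].

Definition is_diskew (sigma tau : {rmorphism D -> D}) (b rho : D)
    (j : D -> R) (x y : R) : Prop :=
  diskew_data sigma tau b rho /\
  exists f : {rmorphism diskew sigma tau b rho -> R},
    [/\ bijective f, forall d, f (pcst d) = j d, f (pgen gX) = x
      & f (pgen gY) = y].

Definition is_gwa (sigma tau : {rmorphism D -> D}) (a : D)
    (j : D -> R) (x y : R) : Prop :=
  gwa_data sigma tau a /\
  exists f : {rmorphism gwa sigma tau a -> R},
    [/\ bijective f, forall d, f (pcst d) = j d, f (pgen gX) = x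
      & f (pgen gY) = y].

Definition is_classical_gwa (sigma : {rmorphism D -> D}) (a : D)
    (j : D -> R) (x y : R) : Prop :=
  exists tau : {rmorphism D -> D},
    [/\ cancel sigma tau, cancel tau sigma, forall d, a * d = d * a
      & is_gwa sigma tau a j x y].

End SkewConstructions.

Definition regular (R : pzRingType) (r : R) : Prop :=
  GRing.lreg r /\ GRing.rreg r.

Definition normal_elt (R : pzRingType) (r : R) : Prop :=
  forall z, (exists s, z = s * r) <-> (exists s, z = r * s).

Definition is_basis (K : pzRingType) (V : lmodType K) (I : eqType) (e : I -> V)
    : Prop :=
  (forall v, exists (s : seq I) (k : I -> K), v = \sum_(i <- s) k i *: e i) /\
  (forall (s : seq I) (k : I -> K), uniq s ->
     \sum_(i <- s) k i *: e i = 0 -> forall i, i \in s -> k i = 0).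

(* Indices start at 0: x_i is the generator i - 1 in 'I_3, q_i is             *)
(* Q 0 (i - 1), b_i is B 0 (i - 1), alpha is M 1 0, mu is M 2 1, etc.         *)

Section BiQuadratic.
Variables (K : fieldType) (Q : 'rV[K]_3) (M : 'M[K]_3) (B : 'rV[K]_3).

Definition bq_rhs (r : 'I_3) : rterm K 'I_3 :=
  (TCst (M r 0%R) * TGen 0%R + TCst (M r 1%R) * TGen 1%R
   + TCst (M r 2%R) * TGen 2%R + TCst (B 0%R r))%RT.

Inductive bq_rel : rterm K 'I_3 -> rterm K 'I_3 -> Prop :=
| bq_central k i : bq_rel (TGen i * TCst k)%RT (TCst k * TGen i)%RT
| bq_21 : bq_rel
   (TGen 1%R * TGen 0%R - TCst (Q 0%R 0%R) * TGen 0%R * TGen 1%R)%RT (bq_rhs 0)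
| bq_31 : bq_rel
   (TGen 2%R * TGen 0%R - TCst (Q 0%R 1%R) * TGen 0%R * TGen 2%R)%RT (bq_rhs 1)
| bq_32 : bq_rel
   (TGen 2%R * TGen 1%R - TCst (Q 0%R 2%R) * TGen 1%R * TGen 2%R)%RT (bq_rhs 2).

Definition bqalg := pres bq_rel.
HB.instance Definition _ := GRing.PzRing.on bqalg.

Definition bq_scale (k : K) (u : bqalg) : bqalg := pcst k * u.

Fact bq_scaleA k l u : bq_scale k (bq_scale l u) = bq_scale (k * l) u.
Proof. by rewrite /bq_scale mulrA -rmorphM. Qed.
Fact bq_scale1 : left_id 1 bq_scale.
Proof. by move=> u; rewrite /bq_scale rmorph1 mul1r. Qed.
Fact bq_scaleDr : right_distributive bq_scale +%R.
Proof. by move=> k u v; rewrite /bq_scale mulrDr. Qed.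
Fact bq_scaleDl u : {morph bq_scale^~ u : k l / k + l}.
Proof. by move=> k l; rewrite /bq_scale rmorphD mulrDl. Qed.

(* bqalg is a K-algebra, but MathComp's algType is for non-trivial rings. *)
HB.instance Definition _ := GRing.Zmodule_isLmodule.Build K bqalg
  bq_scaleA bq_scale1 bq_scaleDr bq_scaleDl.

Lemma bq_scalerAl k (u v : bqalg) : k *: (u * v) = k *: u * v.
Proof. exact: mulrA. Qed.

Lemma bq_scalerAr k (u v : bqalg) : k *: (u * v) = u * (k *: v).
Proof.
suff kC : pcst k * u = u * pcst k by rewrite [LHS]mulrA kC -mulrA.
have piM s t : \pi_bqalg (s * t)%RT = \pi_bqalg s * \pi_bqalg t.
  by rewrite [RHS]pres_piM.
have piD s t : \pi_bqalg (s + t)%RT = \pi_bqalg s + \pi_bqalg t.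
  by rewrite [RHS]pres_piD.
have piN s : \pi_bqalg (- s)%RT = - \pi_bqalg s by rewrite [RHS]pres_piN.
elim/presW: u => s; elim: s => [d|i|s IHs t IHt|s IHs|s IHs t IHt].
- by rewrite -[\pi _]/(pcst d) -!rmorphM mulrC.
- by rewrite -!piM; apply/pres_eqP/rc_sym/rc_rel/bq_central.
- by rewrite piD mulrDr mulrDl IHs IHt.
- by rewrite piN mulrN mulNr IHs.
- by rewrite piM mulrA IHs -!mulrA IHt.
Qed.

Definition bqx (i : 'I_3) : bqalg := pgen i.

Definition pbw : Prop :=
  is_basis (fun e : nat * nat * nat =>
    bqx 0 ^+ e.1.1 * bqx 1 ^+ e.1.2 * bqx 2 ^+ e.2).

(* evaluation K[t] -> bqalg at u; with u = x_3 it identifies K[x_3] with a    *)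
(* subring of the algebra                                                     *)
Definition bq_eval (u : bqalg) (p : {poly K}) : bqalg :=
  \sum_(i < size p) p`_i *: u ^+ i.

End BiQuadratic.

(* sigma is the K-algebra endomorphism of K[t] with t |-> p *)
Definition poly_endo (K : fieldType) (sigma : {rmorphism {poly K} -> {poly K}})
    (p : {poly K}) : Prop :=
  (forall k : K, sigma k%:P = k%:P) /\ sigma 'X = p.

Definition row3 (K : fieldType) (u v w : K) : 'rV[K]_3 :=
  \row_(i < 3) [:: u; v; w]`_i.

Definition mx33 (K : fieldType) (r0 r1 r2 : 'rV[K]_3) : 'M[K]_3 :=
  \matrix_(i < 3) [:: r0; r1; r2]`_i.

(* f : K[x'; Q', M', B'] -> K[x; Q, M, B] identifies the new canonical        *)
(* generators x'_i with the elements l_i x_i + m_i of the original algebra.   *)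
Definition G3_equiv (K : fieldType) (Q : 'rV[K]_3) (M : 'M[K]_3) (B : 'rV[K]_3)
    (Q' : 'rV[K]_3) (M' : 'M[K]_3) (B' : 'rV[K]_3) : Prop :=
  exists (l m : 'I_3 -> K), (forall i, l i != 0) /\
  exists f : {rmorphism bqalg Q' M' B' -> bqalg Q M B},
    [/\ scalable f, bijective f
      & forall i, f (bqx Q' M' B' i) = l i *: bqx Q M B i + pcst (m i)].

(* x2 x1 = q1 x1 x2 + c x3 + b1, x3 x1 = x1 (x3 + al), x3 x2 = x2 (x3 + mu) *)
Section NormalForm.
Variables (K : fieldType) (q1 al mu c b1 : K).

Definition nf_Q : 'rV[K]_3 := row3 q1 1 1.
Definition nf_M : 'M[K]_3 :=
  mx33 (row3 0 0 c) (row3 al 0 0) (row3 0 mu 0).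
Definition nf_B : 'rV[K]_3 := row3 b1 0 0.
Definition nf := bqalg nf_Q nf_M nf_B.
HB.instance Definition _ := GRing.PzRing.on nf.
HB.instance Definition _ := GRing.Lmodule.on nf.
Definition nfx (i : 'I_3) : nf := bqx nf_Q nf_M nf_B i.
Definition nf_eval (p : {poly K}) : nf := bq_eval (nfx 2) p.

End NormalForm.

(* A(q1, al, mu) *)
Notation algA q1 al mu := (nf q1 al mu 0 0).
Notation algAx q1 al mu := (nfx q1 al mu 0 0).

Definition swap_iso (K : fieldType) (q al mu q' al' mu' : K) : Prop :=
  exists f : {rmorphism algA q al mu -> algA q' al' mu'},
    [/\ scalable f, bijective f
      & [/\ f (algAx q al mu 0) = algAx q' al' mu' 1,
            f (algAx q al mu 1) = algAx q' al' mu' 0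
          & f (algAx q al mu 2) = algAx q' al' mu' 2]].

Definition case2a (K : fieldType) (al c b1 : K) : Prop :=
  [/\ al = 0, c \in [:: 0; 1] & b1 \in [:: 0; 1]].
Definition case2b (K : fieldType) (al c b1 : K) : Prop :=
  al = 1 /\ (c, b1) \in [:: (0, 0); (1, 1)].
Definition case2c (K : fieldType) (al c b1 : K) : Prop :=
  [/\ al = 1, c = 0 & b1 = 1] \/ [/\ al = 1, c = 1 & b1 != 1].

Definition exactly_one (P1 P2 P3 : Prop) : Prop :=
  [\/ [/\ P1, ~ P2 & ~ P3], [/\ ~ P1, P2 & ~ P3] | [/\ ~ P1, ~ P2 & P3]].

(* Main.v *)
(* In a PBW basis the two rewritings of x3 x2 x1 agree only if                *)
(* lambda = nu = beta = gamma = 0 and a, b, c, alpha, mu and B satisfy four   *)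
(* equations. As q1 <> 1, translating x1 by b/(q1 - 1) and x2 by a/(q1 - 1)   *)
(* removes a, b, b2 and b3, and rescaling (with a translation of x3 when      *)
(* alpha = 0 <> c) gives the normal forms. The (di)skew polynomial and        *)
(* generalized Weyl descriptions are isomorphisms between presentations,      *)
(* obtained from the universal property in both directions. Regularity of x1  *)
(* and x2 follows from a faithful action of A on K[x3, x1, x2], normality     *)
(* from the automorphisms z |-> x_i z x_i^-1.                                 *)

Require Import Defs.
From HB Require Import structures.
From mathcomp Require Import all_boot all_algebra.
From mathcomp Require Import ring.
Set Implicit Arguments.
Unset Strict Implicit.
Unset Printing Implicit Defensive.
Import GRing.Theory.
Local Open Scope ring_scope.
Local Open Scope quotient_scope.

(** * Universal property of a presentation *)

(** The PBW hypothesis enters through one computation. Rewriting both sides of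
    [(x3 x2) x1 = x3 (x2 x1)] into ordered monomials gives a linear relation between eight monomials
    ([overlap_relation]), so all its coefficients vanish. As [q1 <> 1], the quadratic ones give
    [lambda = beta = nu = gamma = 0], and the others become [mu a = (q1 - 1) b3],
    [alpha b = (q1 - 1) b2], [(alpha + mu) c = 0] and [(alpha + mu) b1 = a b2 + b b3] ([pbw_coef]).

    Put [s = b / (q1 - 1)] and [t = a / (q1 - 1)]. Replacing [x1], [x2] by [x1 + s], [x2 + t] leaves
    only [alpha], [mu], [c] and the constant [b1 + (1 - q1) s t] ([G3_nf]), and the last equation
    says that [alpha + mu] kills this constant. So [alpha + mu <> 0] forces [c] and the constant to
    vanish; otherwise they are normalized by the remaining affine changes.

    In a normal form [x1] and [x2] cross a polynomial in [x3] by shifting it. Each diskew, skew or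
    Weyl description is again a presentation: [pres_liftP] gives morphisms in both directions, and
    [pres_ext] shows that they are inverse to each other because the composites fix constants and
    generators.

    Regularity needs a representation: when [c = b1 = 0] the algebra acts on a polynomial ring whose
    monomials encode normal words, [x1] and [x2] act injectively, and an equivariant map back to the
    algebra sends [1] to [1] ([pres_lreg], [algA_lreg]). An automorphism [F] with [x_i u = F(u) x_i]
    then yields right regularity and normality ([twisted_regular_normal]). *)

Section PresMorphism.
Variables (D : pzRingType) (I : Type) (E : rterm D I -> rterm D I -> Prop).

Section Evaluation.
Variables (R : pzRingType) (phi : D -> R) (g : I -> R).

Fixpoint rt_eval (t : rterm D I) : R :=
  match t with
  | TCst d => phi d
  | TGen i => g i
  | TAdd s t => rt_eval s + rt_eval t
  | TOpp s => - rt_eval s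
  | TMul s t => rt_eval s * rt_eval t
  end.

End Evaluation.

(** Since [rt_eval] computes, this translates between ring identities in [pres E] and formal
    terms. *)
Lemma rt_eval_pi (t : rterm D I) : rt_eval pcst pgen t = \pi_(pres E) t.
Proof.
by elim: t => //= [s -> t ->|s ->|s -> t ->];
  rewrite ?[LHS]pres_piD ?[LHS]pres_piN ?[LHS]pres_piM.
Qed.

Lemma pres_rel s t : E s t ->
  rt_eval pcst pgen s = rt_eval pcst pgen t :> pres E.
Proof. by move=> st; rewrite !rt_eval_pi; exact/pres_eqP/rc_rel. Qed.

Lemma pres_ind (P : pres E -> Prop) :
  (forall d, P (pcst d)) -> (forall i, P (pgen i)) ->
  (forall u v, P u -> P v -> P (u + v)) -> (forall u, P u -> P (- u)) ->
  (forall u v, P u -> P v -> P (u * v)) -> forall u, P u.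
Proof.
move=> Pc Pg PD PN PM; elim/presW=> s; rewrite -rt_eval_pi.
by elim: s => //= [s ? t ?|s ?|s ? t ?]; [exact: PD|exact: PN|exact: PM].
Qed.

(** The solutions [u] form a subring, so constants and generators suffice. With [h = 1] this is
    uniqueness of morphisms; with [h] one of the [x_i] it propagates a commutation rule. *)
Lemma pres_twist (R : pzRingType) (F G : {rmorphism pres E -> R}) (h : R) :
  (forall d, h * F (pcst d) = G (pcst d) * h) ->
  (forall i, h * F (pgen i) = G (pgen i) * h) ->
  forall u, h * F u = G u * h.
Proof.
move=> hc hg; elim/pres_ind => // [u v hu hv|u hu|u v hu hv].
- by rewrite !rmorphD mulrDr mulrDl hu hv.
- by rewrite !rmorphN mulrN mulNr hu.
- by rewrite !rmorphM mulrA hu -mulrA hv mulrA.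
Qed.

Lemma pres_ext (R : pzRingType) (F G : {rmorphism pres E -> R}) :
  (forall d, F (pcst d) = G (pcst d)) -> (forall i, F (pgen i) = G (pgen i)) ->
  F =1 G.
Proof.
move=> hc hg u; rewrite -[LHS]mul1r -[RHS]mulr1.
by apply: pres_twist => x; rewrite mul1r mulr1.
Qed.

Section Lift.
Variables (R : pzRingType) (phi : {rmorphism D -> R}) (g : I -> R).
Hypothesis Eg : forall s t, E s t -> rt_eval phi g s = rt_eval phi g t.

Lemma rt_eval_cong s t : rcong E s t -> rt_eval phi g s = rt_eval phi g t.
Proof.
elim=> {s t} //=; try by move=> *; congruence.
- by move=> d e; rewrite rmorphD.
- by move=> d e; rewrite rmorphM.
- by move=> *; rewrite addrA.
- by move=> *; rewrite addrC.
- by move=> *; rewrite rmorph0 add0r.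
- by move=> *; rewrite rmorph0 addNr.
- by move=> *; rewrite mulrA.
- by move=> *; rewrite rmorph1 mul1r.
- by move=> *; rewrite rmorph1 mulr1.
- by move=> *; rewrite mulrDl.
- by move=> *; rewrite mulrDr.
Qed.

Definition pres_lift (u : pres E) : R := rt_eval phi g (repr u).

Lemma pres_lift_pi s : pres_lift (\pi_(pres E) s) = rt_eval phi g s.
Proof. exact/rt_eval_cong/repr_piP. Qed.

Fact pres_lift_zmod : zmod_morphism pres_lift.
Proof.
elim/presW=> s; elim/presW=> t; rewrite -!rt_eval_pi.
(* The difference in [pres E] is by computation the evaluation of the formal term [s - t]. *)
rewrite -[X in pres_lift X]/(rt_eval pcst pgen (s - t)%RT).
by rewrite !rt_eval_pi !pres_lift_pi.
Qed.

Fact pres_lift_monoid : monoid_morphism pres_lift.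
Proof.
split.
  rewrite -[1]/(rt_eval pcst pgen (TCst 1)) rt_eval_pi pres_lift_pi /=.
  exact: rmorph1.
elim/presW=> s; elim/presW=> t; rewrite -!rt_eval_pi.
rewrite -[X in pres_lift X]/(rt_eval pcst pgen (s * t)%RT).
by rewrite !rt_eval_pi !pres_lift_pi.
Qed.

HB.instance Definition _ := GRing.isZmodMorphism.Build _ _ pres_lift
  pres_lift_zmod.
HB.instance Definition _ := GRing.isMonoidMorphism.Build _ _ pres_lift
  pres_lift_monoid.

Lemma pres_liftP : exists f : {rmorphism pres E -> R},
  (forall d, f (pcst d) = phi d) /\ (forall i, f (pgen i) = g i).
Proof.
by exists pres_lift; split=> x; rewrite -[LHS]/(pres_lift _) pres_lift_pi.
Qed.

End Lift.
End PresMorphism.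

(** * Evaluation of polynomials in a possibly trivial ring *)

Section PolyEvaluation.
Variable R : nzRingType.

Lemma poly_twist (S : pzRingType) (F G : {rmorphism {poly R} -> S}) (h : S) :
  (forall c, h * F c%:P = G c%:P * h) -> h * F 'X = G 'X * h ->
  forall p, h * F p = G p * h.
Proof.
move=> hc hX; elim/poly_ind=> [|p c IHp]; first by rewrite !rmorph0 mulr0 mul0r.
by rewrite !rmorphD !rmorphM mulrDr mulrDl mulrA IHp -mulrA hX hc mulrA.
Qed.

Lemma poly_ext (S : pzRingType) (F G : {rmorphism {poly R} -> S}) :
  (forall c, F c%:P = G c%:P) -> F 'X = G 'X -> F =1 G.
Proof.
move=> hc hX p; rewrite -[LHS]mul1r -[RHS]mulr1.
by apply: poly_twist => [c|]; rewrite mul1r mulr1.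
Qed.

Section LinearEvaluation.
Variables (S : pzRingType) (phi : {additive R -> S}) (e : nat -> S).

(** With [e] the powers of [u] this is evaluation at [u]. With [e] a list of noncommutative words,
    it encodes linear combinations of these words as polynomials, so that comparing them becomes a
    commutative identity for [ring]. *)
Definition leval (p : {poly R}) : S := \sum_(i < size p) phi p`_i * e i.

Lemma leval_widen n (p : {poly R}) : (size p <= n)%N ->
  leval p = \sum_(i < n) phi p`_i * e i.
Proof.
move=> le_pn; rewrite /leval (big_ord_widen n (fun i => phi p`_i * e i)) //.
rewrite big_mkcond; apply: eq_bigr => i _; case: ltnP => // le_pi.
by rewrite nth_default // raddf0 mul0r.
Qed.

Fact leval_zmod : zmod_morphism leval.
Proof.
move=> p q; pose n := maxn (size p) (size q).
rewrite !(@leval_widen n) ?leq_maxl ?leq_maxr //; last first.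
  by rewrite (leq_trans (size_polyD _ _)) // size_polyN.
rewrite -sumrB; apply: eq_bigr => i _.
by rewrite coefB raddfB mulrBl.
Qed.

HB.instance Definition _ := GRing.isZmodMorphism.Build _ _ leval leval_zmod.

Lemma levalCXn c n : leval (c%:P * 'X^n) = phi c * e n.
Proof.
rewrite (@leval_widen n.+1); last first.
  rewrite mul_polyC; apply: leq_trans (size_scale_leq _ _) _.
  by rewrite size_polyXn.
rewrite big_ord_recr /= big1 => [|i _]; rewrite coefCM coefXn.
  by rewrite add0r eqxx mulr1.
by rewrite ltn_eqF // mulr0 raddf0 mul0r.
Qed.

Lemma poly_additive_ext (V : zmodType) (F G : {poly R} -> V) :
  {morph F : p r / p + r} -> {morph G : p r / p + r} ->
  (forall c n, F (c%:P * 'X^n) = G (c%:P * 'X^n)) -> F =1 G.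
Proof.
have morph0 (H : {poly R} -> V) : {morph H : p r / p + r} -> H 0 = 0.
  by move=> HD; apply: (addrI (H 0)); rewrite -HD !addr0.
move=> FD GD FG p; rewrite -(coefK p) poly_def.
rewrite (big_morph F FD (morph0 F FD)) (big_morph G GD (morph0 G GD)).
by apply: eq_bigr => i _; rewrite -mul_polyC FG.
Qed.

End LinearEvaluation.

Variables (S : pzRingType) (phi : {rmorphism R -> S}) (u : S).
Hypothesis uC : forall c, u * phi c = phi c * u.

Definition peval : {poly R} -> S := leval phi (fun i => u ^+ i).
HB.instance Definition _ := GRing.Additive.on peval.

Lemma pevalC c : peval c%:P = phi c.
Proof.
by rewrite /peval (leval_widen _ _ (size_polyC_leq1 c)) big_ord1 coefC mulr1.
Qed.

Lemma pevalMX p : peval (p * 'X) = peval p * u.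
Proof.
rewrite /peval (@leval_widen _ _ _ (size p).+1); last first.
  by rewrite (leq_trans (size_polyMleq _ _)) // size_polyX addn2.
rewrite big_ord_recl coefMX /= rmorph0 mul0r add0r mulr_suml.
by apply: eq_bigr => i _; rewrite coefMX /= exprSr mulrA.
Qed.

(** Multiplicativity of [peval] rests on this: by [uC], [phi c] crosses every power of [u]. *)
Lemma pevalMC p c : peval (p * c%:P) = peval p * phi c.
Proof.
rewrite /peval (@leval_widen _ _ _ (size p)); last first.
  rewrite (leq_trans (size_polyMleq _ _)) //.
  have [->|c0] := eqVneq c 0; first by rewrite size_poly0 addn0 leq_pred.
  by rewrite size_polyC c0 addn1.
rewrite mulr_suml; apply: eq_bigr => i _.
rewrite coefMC /= rmorphM -!mulrA; congr (_ * _).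
elim: (val i) => [|j IHj]; first by rewrite !expr0 mulr1 mul1r.
by rewrite exprSr mulrA IHj -!mulrA uC.
Qed.

Fact peval_monoid : monoid_morphism peval.
Proof.
split; first by rewrite -polyC1 pevalC rmorph1.
move=> p; elim/poly_ind=> [|q c IHq]; first by rewrite mulr0 raddf0 mulr0.
rewrite mulrDr mulrA !raddfD /= !pevalMX pevalMC IHq -mulrA.
by rewrite pevalC mulrDr.
Qed.

HB.instance Definition _ := GRing.isMonoidMorphism.Build _ _ peval peval_monoid.

Lemma pevalP : exists f : {rmorphism {poly R} -> S},
  [/\ f =1 peval, forall c, f c%:P = phi c & f 'X = u].
Proof.
exists peval; split=> //; first exact: pevalC.
by rewrite -[LHS]/(peval 'X) -['X]mul1r pevalMX -polyC1 pevalC rmorph1 mul1r.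
Qed.

End PolyEvaluation.

(** * The PBW condition and affine changes of generators *)

Section Overlap.
Variables (K : fieldType) (R : pzRingType) (phi : {rmorphism K -> R}).
Variables (q a b c d al be ga b2 la mu nu b3 : K) (x y z : R).
Hypothesis xC : forall k, x * phi k = phi k * x.
Hypothesis yC : forall k, y * phi k = phi k * y.
Hypothesis zC : forall k, z * phi k = phi k * z.
Hypothesis yx :
  y * x = phi q * x * y + phi a * x + phi b * y + phi c * z + phi d.
Hypothesis zx :
  z * x = x * z + phi al * x + phi be * y + phi ga * z + phi b2.
Hypothesis zy :
  z * y = y * z + phi la * x + phi mu * y + phi nu * z + phi b3.

(* The two ways of rewriting [z * y * x] into ordered monomials. *)
Lemma overlap_relation :
  phi (la * (1 - q)) * (x * x) + phi (be * (1 - q)) * (y * y)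
  + phi (nu * (1 - q)) * (x * z) + phi (ga * (1 - q)) * (y * z)
  + phi (mu * a + (1 - q) * b3 + nu * al - q * ga * la - b * la) * x
  + phi (al * b + (1 - q) * b2 + nu * be - q * ga * mu - a * be) * y
  + phi ((al + mu) * c + (1 - q) * ga * nu - a * ga - b * nu) * z
  + phi ((al + mu) * d + nu * b2 - q * ga * b3 - a * b2 - b * b3) = 0.
Proof.
have C := (xC, yC, zC).
have Cr u k : (u * x * phi k = u * phi k * x) * (u * y * phi k = u * phi k * y)
    * (u * z * phi k = u * phi k * z) by rewrite -!mulrA !C.
have yxr u : u * y * x = u * phi q * x * y + u * phi a * x + u * phi b * y
    + u * phi c * z + u * phi d by rewrite -mulrA yx !mulrDr !mulrA.
have zxr u : u * z * x = u * x * z + u * phi al * x + u * phi be * y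
    + u * phi ga * z + u * phi b2 by rewrite -mulrA zx !mulrDr !mulrA.
have zyr u : u * z * y = u * y * z + u * phi la * x + u * phi mu * y
    + u * phi nu * z + u * phi b3 by rewrite -mulrA zy !mulrDr !mulrA.
have LR : (z * y) * x - z * (y * x) = 0 by rewrite mulrA subrr.
rewrite {1}zy yx in LR.
rewrite !(mulrDl, mulrDr, mulrA, C, Cr, yx, zx, zy, yxr, zxr, zyr) in LR.
rewrite -!rmorphM in LR.
(* ['X^n] encodes the word at position [n]. Words 0 to 7 occur in the conclusion; the last three
   cancel. *)
pose e := nth 0
  [:: x * x; y * y; x * z; y * z; x; y; z; 1; x * y * z; x * y; z * z].
have E k n : phi k * e n = leval phi e (k%:P * 'X^n) by rewrite levalCXn.
have e0 k : phi k * x * x = leval phi e (k%:P * 'X^0) by rewrite -E !mulrA.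
have e1 k : phi k * y * y = leval phi e (k%:P * 'X^1) by rewrite -E !mulrA.
have e2 k : phi k * x * z = leval phi e (k%:P * 'X^2) by rewrite -E !mulrA.
have e3 k : phi k * y * z = leval phi e (k%:P * 'X^3) by rewrite -E !mulrA.
have e4 k : phi k * x = leval phi e (k%:P * 'X^4) by rewrite -E.
have e5 k : phi k * y = leval phi e (k%:P * 'X^5) by rewrite -E.
have e6 k : phi k * z = leval phi e (k%:P * 'X^6) by rewrite -E.
have e7 k : phi k = leval phi e (k%:P * 'X^7) by rewrite -E mulr1.
have e8 k : phi k * x * y * z = leval phi e (k%:P * 'X^8) by rewrite -E !mulrA.
have e9 k : phi k * x * y = leval phi e (k%:P * 'X^9) by rewrite -E !mulrA.
have e10 k : phi k * z * z = leval phi e (k%:P * 'X^10) by rewrite -E !mulrA.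
(* Longer words are encoded first, because a shorter one may be a prefix of them. *)
rewrite -LR !mulrA !(e8, e0, e1, e2, e3, e9, e10, e4, e5, e6, e7).
rewrite -!(raddfB, raddfD) /=; congr (leval phi e _); rewrite !rmorphE; ring.
Qed.

End Overlap.

Section AffineChange.
Variables (K : fieldType) (R : pzRingType) (phi : {rmorphism K -> R}).
Variables (y : 'I_3 -> R) (l m : 'I_3 -> K).
Hypothesis yC : forall i k, y i * phi k = phi k * y i.
Let y' i := phi (l i) * y i + phi (m i).

(** The new left side is [l_i l_j] times the old one plus [(1 - q) (l_j m_i y_j + l_i m_j y_i + m_i
    m_j)]; the two hypotheses compare its linear and constant coefficients with the new right
    side. *)
Lemma affine_row (i j : 'I_3) (q b b' : K) (M M' : 'I_3 -> K) :
  y j * y i - phi q * y i * y j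
    = phi (M 0) * y 0 + phi (M 1) * y 1 + phi (M 2) * y 2 + phi b ->
  (forall k, M' k * l k = l i * l j * M k
     + (1 - q) * (l j * m i * (k == j)%:R + l i * m j * (k == i)%:R)) ->
  M' 0 * m 0 + M' 1 * m 1 + M' 2 * m 2 + b'
    = l i * l j * b + (1 - q) * m i * m j ->
  y' j * y' i - phi q * y' i * y' j
    = phi (M' 0) * y' 0 + phi (M' 1) * y' 1 + phi (M' 2) * y' 2 + phi b'.
Proof.
move=> /(canRL (subrK _)) yji MM' bb'.
pose e := nth 0 [:: y 0; y 1; y 2; y i * y j; 1].
have E k n : phi k * e n = leval phi e (k%:P * 'X^n) by rewrite levalCXn.
have ye (k : 'I_3) : y k = e k.
  by case: k => [[|[|[|]]]] // h; congr y; apply: val_inj.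
(* As [i] and [j] are variables, ['X^i] and ['X^j] are expanded over the same indicators as in
   [MM']. *)
have X3 (k : 'I_3) : 'X^k = ((0 == k)%:R)%:P + ((1 == k)%:R)%:P * 'X
    + ((2 == k)%:R)%:P * 'X^2 :> {poly K}.
  case: k => [[|[|[|]]]] //= h;
    by rewrite ?expr0 ?expr1 ?mul1r ?mul0r ?addr0 ?add0r.
have e3 k : phi k * y i * y j = leval phi e (k%:P * 'X^3) by rewrite -E mulrA.
have ey k n : phi k * y n = leval phi e (k%:P * 'X^n) by rewrite -E -ye.
have e4 k : phi k = leval phi e (k%:P * 'X^4) by rewrite -E mulr1.
have yCr u (n : 'I_3) k : u * y n * phi k = u * phi k * y n.
  by rewrite -!mulrA yC.
have yjir u : u * y j * y i = u * phi q * y i * y j + u * phi (M 0) * y 0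
    + u * phi (M 1) * y 1 + u * phi (M 2) * y 2 + u * phi b.
  by rewrite -mulrA yji !mulrDr !mulrA addrC !addrA.
rewrite /y' !(mulrDl, mulrDr, mulrA, yC, yCr, yjir) -!rmorphM.
rewrite !(e3, ey, e4) -!(raddfB, raddfD) /=; congr (leval phi e _).
rewrite -[((1 %% 3 + 1 %% 3) %% 3)%N]/2%N -[(1 %% 3)%N]/1%N (X3 i) (X3 j) !MM'.
have -> : b' = l i * l j * b + (1 - q) * m i * m j
    - (M' 0 * m 0 + M' 1 * m 1 + M' 2 * m 2) by rewrite -bb'; ring.
rewrite !rmorphE; ring.
Qed.

End AffineChange.

Section BiQuadraticMorphisms.
Variables (K : fieldType) (Q : 'rV[K]_3) (M : 'M[K]_3) (B : 'rV[K]_3).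
Local Notation A := (bqalg Q M B).
Local Notation x := (bqx Q M B).

(** Relation [r] links [x (hi r)] and [x (lo r)], which lets one formula treat all three
    relations. *)
Definition lo (r : 'I_3) : 'I_3 := [:: 0; 0; 1]`_r.
Definition hi (r : 'I_3) : 'I_3 := [:: 1; 2; 2]`_r.

Lemma ord3P (P : 'I_3 -> Prop) : P 0 -> P 1 -> P 2 -> forall i, P i.
Proof.
move=> P0 P1 P2; case=> [[|[|[|]]]] // h.
- by rewrite (_ : Ordinal h = 0) //; apply: val_inj.
- by rewrite (_ : Ordinal h = 1) //; apply: val_inj.
- by rewrite (_ : Ordinal h = 2) //; apply: val_inj.
Qed.

Lemma bqxC i k : x i * pcst k = pcst k * x i.
Proof. exact: pres_rel (bq_central Q M B k i). Qed.

Lemma bqx_rel r : x (hi r) * x (lo r) - pcst (Q 0 r) * x (lo r) * x (hi r)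
  = rt_eval pcst x (bq_rhs M B r).
Proof.
by elim/ord3P: r;
  [exact: pres_rel (bq_21 Q M B)|exact: pres_rel (bq_31 Q M B)
  |exact: pres_rel (bq_32 Q M B)].
Qed.

Lemma bq_liftP (R : pzRingType) (phi : {rmorphism K -> R}) (y : 'I_3 -> R) :
  (forall i k, y i * phi k = phi k * y i) ->
  (forall r, y (hi r) * y (lo r) - phi (Q 0 r) * y (lo r) * y (hi r)
     = rt_eval phi y (bq_rhs M B r)) ->
  exists f : {rmorphism A -> R},
    (forall k, f (pcst k) = phi k) /\ (forall i, f (x i) = y i).
Proof.
move=> yC yrel; apply: pres_liftP => s t [k i|||]; first exact: yC.
- exact: (yrel 0).
- exact: (yrel 1).
- exact: (yrel 2).
Qed.

Lemma bq_ext (R : pzRingType) (F G : {rmorphism A -> R}) :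
  (forall k, F (pcst k) = G (pcst k)) -> (forall i, F (x i) = G (x i)) ->
  F =1 G.
Proof. exact: pres_ext. Qed.

End BiQuadraticMorphisms.

Lemma bq_affine (K : fieldType) (Q : 'rV[K]_3) (M M' : 'M[K]_3)
    (B B' : 'rV[K]_3) (l m : 'I_3 -> K) :
  (forall r k, M' r k * l k = l (lo r) * l (hi r) * M r k + (1 - Q 0 r)
     * (l (hi r) * m (lo r) * (k == hi r)%:R
        + l (lo r) * m (hi r) * (k == lo r)%:R)) ->
  (forall r, M' r 0 * m 0 + M' r 1 * m 1 + M' r 2 * m 2 + B' 0 r
     = l (lo r) * l (hi r) * B 0 r + (1 - Q 0 r) * m (lo r) * m (hi r)) ->
  exists f : {rmorphism bqalg Q M' B' -> bqalg Q M B},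
    (forall k, f (pcst k) = pcst k) /\
    (forall i, f (bqx Q M' B' i) = l i *: bqx Q M B i + pcst (m i)).
Proof.
move=> MM' BB'; apply: bq_liftP => [i k|r].
  by rewrite mulrDl mulrDr -!rmorphM mulrC -bq_scalerAl bqxC bq_scalerAr.
exact: (affine_row (@bqxC _ Q M B) (bqx_rel Q M B r) (MM' r) (BB' r)).
Qed.

(** The inverse change has factors [(l i)^-1] and translations [- (m i / l i)]; this is its
    coefficient condition in [bq_affine], with [M] and [M'] exchanged. Here [da], [db] are the
    indicators of [k = hi r], [k = lo r], and [c = l k] equals [b], respectively [a], in these
    cases. *)
Lemma affine_coef_inv (K : fieldType) (a b c u q v w da db : K) :
  a != 0 -> b != 0 -> c != 0 -> da = 0 \/ c = b -> db = 0 \/ c = a ->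
  u * c^-1 = a^-1 * b^-1
      * ((a * b * u + (1 - q) * (b * v * da + a * w * db)) / c)
    + (1 - q) * (b^-1 * - (v / a) * da + a^-1 * - (w / b) * db).
Proof.
by move=> a0 b0 c0 [->|cb] [->|ca]; subst; field; do ?[apply/andP; split].
Qed.

Lemma G3_equivI (K : fieldType) (Q : 'rV[K]_3) (M M' : 'M[K]_3)
    (B B' : 'rV[K]_3) (l m : 'I_3 -> K) :
  (forall i, l i != 0) ->
  (forall r k, M' r k * l k = l (lo r) * l (hi r) * M r k + (1 - Q 0 r)
     * (l (hi r) * m (lo r) * (k == hi r)%:R
        + l (lo r) * m (hi r) * (k == lo r)%:R)) ->
  (forall r, M' r 0 * m 0 + M' r 1 * m 1 + M' r 2 * m 2 + B' 0 r
     = l (lo r) * l (hi r) * B 0 r + (1 - Q 0 r) * m (lo r) * m (hi r)) ->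
  G3_equiv Q M B Q M' B'.
Proof.
move=> l0 MM' BB'; exists l, m; split=> //.
have [f [fc fx]] := bq_affine MM' BB'.
have M'E r k : M' r k = (l (lo r) * l (hi r) * M r k + (1 - Q 0 r)
     * (l (hi r) * m (lo r) * (k == hi r)%:R
        + l (lo r) * m (hi r) * (k == lo r)%:R)) / l k.
  by rewrite -MM' mulfK.
have B'E r : B' 0 r
     = l (lo r) * l (hi r) * B 0 r + (1 - Q 0 r) * m (lo r) * m (hi r)
       - (M' r 0 * m 0 + M' r 1 * m 1 + M' r 2 * m 2).
  by rewrite -BB' addrC addKr.
pose l' i := (l i)^-1; pose m' i := - (m i / l i).
have [] := @bq_affine K Q M' M B' B l' m'.
- move=> r k; rewrite M'E /l' /m'.
  apply: affine_coef_inv => //.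
    by have [->|] := eqVneq k (hi r); [right|left].
  by have [->|] := eqVneq k (lo r); [right|left].
- move=> r; rewrite B'E !M'E /l' /m'.
  by elim/ord3P: r; rewrite /lo /hi /=; field; rewrite !l0.
move=> g [gc gx]; exists f; split.
- by move=> k u; rewrite -[k *: u]/(pcst k * u) rmorphM fc.
- exists g => u.
    rewrite -[LHS]/((g \o f) u) -[RHS]/(idfun u); apply: bq_ext => [k|i] /=.
      by rewrite fc gc.
    rewrite fx rmorphD -[l i *: _]/(pcst (l i) * _) rmorphM !gc gx.
    rewrite -[l' i *: _]/(pcst (l' i) * _) mulrDr mulrA -addrA -!rmorphM.
    rewrite -rmorphD.
    by rewrite divff // rmorph1 mul1r mulrN mulrC divfK // addNr rmorph0 addr0.
  rewrite -[LHS]/((f \o g) u) -[RHS]/(idfun u); apply: bq_ext => [k|i] /=.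
    by rewrite gc fc.
  rewrite gx rmorphD -[l' i *: _]/(pcst (l' i) * _) rmorphM !fc fx.
  rewrite -[l i *: _]/(pcst (l i) * _) mulrDr mulrA -addrA -!rmorphM -rmorphD.
  by rewrite mulVf // rmorph1 mul1r mulrC subrr rmorph0 addr0.
- exact: fx.
Qed.

(** * The normal forms *)

Section NormalFormPresentation.
Variables (K : fieldType) (q al mu c b : K).
Local Notation A := (nf q al mu c b).
Local Notation x := (nfx q al mu c b).

Lemma row3E (u v w : K) (i : 'I_3) : row3 u v w 0 i = [:: u; v; w]`_i.
Proof. by rewrite mxE. Qed.

Lemma nf_QE r : nf_Q q 0 r = [:: q; 1; 1]`_r.
Proof. exact: row3E. Qed.

Lemma nf_ME r j :
  nf_M al mu c r j = [:: row3 0 0 c; row3 al 0 0; row3 0 mu 0]`_r 0 j.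
Proof. by rewrite mxE. Qed.

Lemma nf_BE r : nf_B b 0 r = [:: b; 0; 0]`_r.
Proof. exact: row3E. Qed.

Definition nfE := (nf_QE, nf_ME, nf_BE, row3E).

Lemma nfxC i k : x i * pcst k = pcst k * x i.
Proof. exact: bqxC. Qed.

Lemma nf_x1x0 : x 1 * x 0 = pcst q * x 0 * x 1 + pcst c * x 2 + pcst b.
Proof.
have := bqx_rel (nf_Q q) (nf_M al mu c) (nf_B b) 0; rewrite /=. rewrite !nfE /=.
rewrite !rmorph0 !mul0r !add0r => /(canRL (subrK _)) h.
by rewrite [LHS]h addrC addrA.
Qed.

Lemma nf_x2x0 : x 2 * x 0 = x 0 * (x 2 + pcst al).
Proof.
have := bqx_rel (nf_Q q) (nf_M al mu c) (nf_B b) 1; rewrite /= !nfE /=.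
rewrite !rmorph0 !rmorph1 !mul0r mul1r !addr0 => /(canRL (subrK _)) h.
by rewrite [LHS]h addrC mulrDr nfxC.
Qed.

Lemma nf_x2x1 : x 2 * x 1 = x 1 * (x 2 + pcst mu).
Proof.
have := bqx_rel (nf_Q q) (nf_M al mu c) (nf_B b) 2; rewrite /= !nfE /=.
rewrite !rmorph0 !rmorph1 !mul0r mul1r !addr0 add0r => /(canRL (subrK _)) h.
by rewrite [LHS]h addrC mulrDr nfxC.
Qed.

Lemma nf_x0x2 : x 0 * x 2 = (x 2 - pcst al) * x 0.
Proof. by rewrite mulrBl nf_x2x0 mulrDr nfxC addrK. Qed.

Lemma nf_x1x2 : x 1 * x 2 = (x 2 - pcst mu) * x 1.
Proof. by rewrite mulrBl nf_x2x1 mulrDr nfxC addrK. Qed.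

Lemma nf_ext (R : pzRingType) (F G : {rmorphism A -> R}) :
  (forall k, F (pcst k) = G (pcst k)) ->
  F (x 0) = G (x 0) -> F (x 1) = G (x 1) -> F (x 2) = G (x 2) -> F =1 G.
Proof. by move=> hk h0 h1 h2; apply: pres_ext => //; apply: ord3P. Qed.

Lemma nf_liftP (R : pzRingType) (phi : {rmorphism K -> R}) (y0 y1 y2 : R) :
  (forall k, y0 * phi k = phi k * y0) -> (forall k, y1 * phi k = phi k * y1) ->
  (forall k, y2 * phi k = phi k * y2) ->
  y1 * y0 = phi q * y0 * y1 + phi c * y2 + phi b ->
  y2 * y0 = y0 * (y2 + phi al) -> y2 * y1 = y1 * (y2 + phi mu) ->
  exists f : {rmorphism A -> R}, [/\ forall k, f (pcst k) = phi k,
    f (x 0) = y0, f (x 1) = y1 & f (x 2) = y2].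
Proof.
move=> C0 C1 C2 h10 h20 h21; pose y (i : 'I_3) := [:: y0; y1; y2]`_i.
have yC i k : y i * phi k = phi k * y i by elim/ord3P: i.
have [|f [fk fx]] := @bq_liftP _ (nf_Q q) (nf_M al mu c) (nf_B b) _ phi y yC.
  elim/ord3P; rewrite /= !nfE /= /y /= !rmorph0 ?rmorph1 !mul0r.
  - by rewrite h10 -[_ + _ + phi b]addrA [LHS]addrC addKr !add0r.
  - by rewrite h20 mulrDr mul1r addrC addKr C0 !addr0.
  - by rewrite h21 mulrDr mul1r addrC addKr C1 !addr0 add0r.
by exists f; split=> //; rewrite [LHS]fx.
Qed.

(** Scaling by [k] is by definition multiplication by [pcst k], so [nf_eval] is an instance of
    [peval]. *)
Lemma nf_evalP : exists ev : {rmorphism {poly K} -> A},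
  [/\ ev =1 nf_eval q al mu c b, forall k, ev k%:P = pcst k & ev 'X = x 2].
Proof. exact: (pevalP (nfxC 2)). Qed.

End NormalFormPresentation.

(** * Universal properties of skew, diskew and generalized Weyl presentations *)

Section SkewLifts.
Variables (D R : pzRingType) (phi : {rmorphism D -> R}).

Lemma skew_liftP (nu : {rmorphism D -> D}) (h : R) :
  (forall d, h * phi d = phi (nu d) * h) ->
  exists f : {rmorphism skew_poly nu -> R},
    (forall d, f (pcst d) = phi d) /\ f (pgen tt) = h.
Proof.
move=> hphi.
have [|f [fc fg]] := @pres_liftP _ _ (skew_rel nu) _ phi (fun=> h).
  by move=> s t [d]; exact: hphi.
by exists f; split=> //; apply: fg.
Qed.

Definition xy_gen (x y : R) (i : xy) : R := if i is gX then x else y.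

Lemma diskew_liftP (sigma tau : {rmorphism D -> D}) (b rho : D) (x y : R) :
  (forall d, x * phi d = phi (sigma d) * x) ->
  (forall d, y * phi d = phi (tau d) * y) ->
  x * y - phi rho * y * x = phi b ->
  exists f : {rmorphism diskew sigma tau b rho -> R},
    [/\ forall d, f (pcst d) = phi d, f (pgen gX) = x & f (pgen gY) = y].
Proof.
move=> hx hy hxy.
have [|f [fc fg]] :=
    @pres_liftP _ _ (diskew_rel sigma tau b rho) _ phi (xy_gen x y).
  by move=> s t [d|d|] /=.
by exists f; split=> //; apply: fg.
Qed.

Lemma gwa_liftP (sigma tau : {rmorphism D -> D}) (a : D) (x y : R) :
  (forall d, x * phi d = phi (sigma d) * x) ->
  (forall d, y * phi d = phi (tau d) * y) ->
  y * x = phi a -> x * y = phi (sigma a) ->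
  exists f : {rmorphism gwa sigma tau a -> R},
    [/\ forall d, f (pcst d) = phi d, f (pgen gX) = x & f (pgen gY) = y].
Proof.
move=> hx hy hyx hxy.
have [|f [fc fg]] := @pres_liftP _ _ (gwa_rel sigma tau a) _ phi (xy_gen x y).
  by move=> s t [d|d||] /=.
by exists f; split=> //; apply: fg.
Qed.

End SkewLifts.

Section SkewRelations.
Variable D : pzRingType.

Lemma skewE (nu : {rmorphism D -> D}) d :
  pgen tt * pcst d = pcst (nu d) * pgen tt :> skew_poly nu.
Proof. exact: pres_rel (skew_h nu d). Qed.

Variables (sigma tau : {rmorphism D -> D}).

Lemma diskewXE b rho d :
  pgen gX * pcst d = pcst (sigma d) * pgen gX :> diskew sigma tau b rho.
Proof. exact: pres_rel (diskew_x sigma tau b rho d). Qed.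

Lemma diskewYE b rho d :
  pgen gY * pcst d = pcst (tau d) * pgen gY :> diskew sigma tau b rho.
Proof. exact: pres_rel (diskew_y sigma tau b rho d). Qed.

Lemma diskewXYE b rho : pgen gX * pgen gY - pcst rho * pgen gY * pgen gX
  = pcst b :> diskew sigma tau b rho.
Proof. exact: pres_rel (diskew_xy sigma tau b rho). Qed.

Lemma gwaXE a d :
  pgen gX * pcst d = pcst (sigma d) * pgen gX :> gwa sigma tau a.
Proof. exact: pres_rel (gwa_x sigma tau a d). Qed.

Lemma gwaYE a d :
  pgen gY * pcst d = pcst (tau d) * pgen gY :> gwa sigma tau a.
Proof. exact: pres_rel (gwa_y sigma tau a d). Qed.

Lemma gwaYXE a : pgen gY * pgen gX = pcst a :> gwa sigma tau a.
Proof. exact: pres_rel (gwa_yx sigma tau a). Qed.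

Lemma gwaXYE a : pgen gX * pgen gY = pcst (sigma a) :> gwa sigma tau a.
Proof. exact: pres_rel (gwa_xy sigma tau a). Qed.

End SkewRelations.

Lemma poly_endoP (K : fieldType) (p : {poly K}) :
  exists sigma : {rmorphism {poly K} -> {poly K}}, poly_endo sigma p.
Proof.
exists (comp_poly p); split=> [k|] /=; first exact: comp_polyC.
exact: comp_polyX.
Qed.

Lemma poly_endo_shiftC (K : fieldType)
    (sigma tau : {rmorphism {poly K} -> {poly K}}) (s t : K) :
  poly_endo sigma ('X + s%:P) -> poly_endo tau ('X + t%:P) ->
  forall p, sigma (tau p) = tau (sigma p).
Proof.
move=> [sC sX] [tC tX] p.
rewrite -[LHS]/((sigma \o tau) p) -[RHS]/((tau \o sigma) p).
apply: poly_ext => [c|] /=; first by rewrite tC sC tC.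
by rewrite tX sX !rmorphD /= sX sC tX tC addrAC.
Qed.

(** * Normal forms as diskew, iterated skew and generalized Weyl rings *)

Section NormalFormStructure.
Variables (K : fieldType) (q al mu c b : K).
Local Notation A := (nf q al mu c b).
Local Notation x := (nfx q al mu c b).
Local Notation ev := (nf_eval q al mu c b).
Variables sigma tau : {rmorphism {poly K} -> {poly K}}.
Hypothesis sigmaP : poly_endo sigma ('X - mu%:P).
Hypothesis tauP : poly_endo tau ('X - al%:P).

Lemma shiftsC p : sigma (tau p) = tau (sigma p).
Proof.
move: sigmaP tauP; rewrite -!rmorphN => sP tP.
exact: (poly_endo_shiftC sP tP).
Qed.

Lemma nf_x1_eval p : x 1 * ev p = ev (sigma p) * x 1.
Proof.
have [f [fE fC fX]] := nf_evalP q al mu c b; rewrite -!fE.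
apply: (@poly_twist _ _ f (f \o sigma)) => [k|] /=.
  by rewrite sigmaP.1 fC nfxC.
by rewrite sigmaP.2 rmorphB /= fC fX nf_x1x2.
Qed.

Lemma nf_x0_eval p : x 0 * ev p = ev (tau p) * x 0.
Proof.
have [f [fE fC fX]] := nf_evalP q al mu c b; rewrite -!fE.
apply: (@poly_twist _ _ f (f \o tau)) => [k|] /=.
  by rewrite tauP.1 fC nfxC.
by rewrite tauP.2 rmorphB /= fC fX nf_x0x2.
Qed.

(** [sigma \o tau] shifts ['X] by [- (al + mu)], so the diskew condition on [p] follows once
    [al + mu] kills [p]. This serves both [p = 0] and [al + mu = 0]. *)
Lemma nf_diskew (p : {poly K}) :
  p = c *: 'X + b%:P -> (al + mu)%:P * p = 0 ->
  is_diskew sigma tau p q%:P ev (x 1) (x 0).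
Proof.
move=> pE p0; split=> [d|].
  split; first by rewrite shiftsC mulrC.
  have -> : sigma (tau d) * p = (sigma \o tau) d * p by [].
  rewrite -(@poly_twist _ _ idfun (sigma \o tau) p) //= => [k|].
    by rewrite tauP.1 sigmaP.1 mulrC.
  rewrite tauP.2 rmorphB /= sigmaP.1 sigmaP.2.
  have -> : ('X - mu%:P - al%:P) * p = p * 'X - (al + mu)%:P * p.
    by rewrite rmorphD; ring.
  by rewrite p0 subr0.
have [f [fE fC fX]] := nf_evalP q al mu c b.
have [d|d||F [Fc F1 F0]] := @diskew_liftP _ _ f sigma tau p q%:P (x 1) (x 0).
- by rewrite !fE nf_x1_eval.
- by rewrite !fE nf_x0_eval.
- rewrite pE nf_x1x0 rmorphD -mul_polyC rmorphM !fC fX.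
  by rewrite -[_ + _ + pcst b]addrA [LHS]addrC addKr.
have [k|k|k||||G [Gc G0 G1 G2]] := @nf_liftP _ q al mu c b _
  (@pcst _ _ (diskew_rel sigma tau p q%:P) \o polyC)
  (pgen gY) (pgen gX) (pcst 'X).
- by rewrite /= diskewYE tauP.1.
- by rewrite /= diskewXE sigmaP.1.
- by rewrite /= -!rmorphM mulrC.
- rewrite /=; have := diskewXYE sigma tau p q%:P => /(canRL (subrK _)) ->.
  suff -> : pcst p = pcst c%:P * pcst 'X + pcst b%:P :> diskew sigma tau p q%:P.
    by rewrite addrC addrA.
  by rewrite -rmorphM -rmorphD mul_polyC -pE.
- by rewrite /= -rmorphD diskewYE rmorphD tauP.1 tauP.2 subrK.
- by rewrite /= -rmorphD diskewXE rmorphD sigmaP.1 sigmaP.2 subrK.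
(* On the base ring [K[x3]] the round trip is settled by constants and ['X]. *)
have Gf : G \o f =1 pcst.
  by apply: poly_ext => [k|] /=; [rewrite fC Gc|rewrite fX G2].
exists F; split=> // [|d]; last by rewrite Fc fE.
exists G => u.
  rewrite -[LHS]/((G \o F) u) -[RHS]/(idfun u).
  by apply: pres_ext => [d|[]] /=; rewrite ?F0 ?F1 // Fc; apply: Gf.
rewrite -[LHS]/((F \o G) u) -[RHS]/(idfun u).
by apply: nf_ext => [k|||] /=; rewrite ?Gc ?G0 ?G1 ?G2 //= Fc ?fC ?fX.
Qed.

(** Without [c] and [b], the relation between [x 1] and [x 0] is a skew commutation rule over
    [K[x3][x 0; tau]]. The twist [sigma2] respects the relation of that ring because [sigma] and
    [tau] commute. *)
Lemma nf_skew_poly : c = 0 -> b = 0 ->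
  let D1 := skew_poly tau in
  let y1 : D1 := pgen tt in
  exists (sigma2 : {rmorphism D1 -> D1}) (j : D1 -> A),
    [/\ forall k : K, sigma2 (pcst k%:P) = pcst k%:P,
        sigma2 (pcst 'X) = pcst ('X - mu%:P),
        sigma2 y1 = pcst q%:P * y1,
        (forall p, j (pcst p) = ev p) /\ j y1 = x 0
      & is_skew_poly sigma2 j (x 1)].
Proof.
move=> c0 b0 D1 y1.
have [f [fE fC fX]] := nf_evalP q al mu c b.
have [p|s2 [s2c s2y]] := @skew_liftP _ D1 (pcst \o sigma) tau (pcst q%:P * y1).
  by rewrite /= -mulrA skewE !mulrA -!rmorphM shiftsC mulrC.
have [p|j [jc jy]] := @skew_liftP _ _ f tau (x 0).
  by rewrite !fE nf_x0_eval.
have x1j d : x 1 * j d = j (s2 d) * x 1.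
  apply: (@pres_twist _ _ _ _ j (j \o s2)) => [p|[]] /=.
    by rewrite s2c !jc !fE nf_x1_eval.
  rewrite s2y rmorphM !jc !jy fC nf_x1x0 c0 b0 !rmorph0 mul0r !addr0 //.
exists s2, j; split=> //; try by rewrite s2c.
- by move=> k; rewrite s2c /= sigmaP.1.
- by rewrite s2c /= sigmaP.2.
- by split=> [p|]; rewrite ?jc ?fE.
have [F [Fc Fx]] := skew_liftP x1j.
have [k|k|k||||G [Gc G0 G1 G2]] := @nf_liftP _ q al mu c b (skew_poly s2)
  (pcst \o pcst \o polyC) (pcst y1) (pgen tt) (pcst (pcst 'X)).
- by rewrite /= -!rmorphM skewE tauP.1.
- by rewrite /= skewE s2c /= sigmaP.1.
- by rewrite /= -!rmorphM mulrC.
- by rewrite /= skewE s2y c0 b0 !rmorphM !rmorph0 mul0r !addr0.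
- by rewrite /= -rmorphD -!rmorphM -rmorphD skewE rmorphD tauP.1 tauP.2 subrK.
- by rewrite /= -!rmorphD skewE s2c /= rmorphD sigmaP.1 sigmaP.2 subrK.
exists F; split=> //.
have Gf : G \o f =1 pcst \o pcst.
  by apply: poly_ext => [k|] /=; [rewrite fC Gc|rewrite fX G2].
have Gj : G \o j =1 pcst.
  by apply: pres_ext => [p|[]] /=; [rewrite jc; apply: Gf|rewrite jy G0].
exists G => u.
  rewrite -[LHS]/((G \o F) u) -[RHS]/(idfun u).
  by apply: pres_ext => [d|[]] /=; rewrite ?Fx ?G1 // Fc; apply: Gj.
rewrite -[LHS]/((F \o G) u) -[RHS]/(idfun u).
by apply: nf_ext => [k|||] /=; rewrite ?Gc ?G0 ?G1 ?G2 //= Fc ?jy ?jc ?fC ?fX.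
Qed.

(** The element [x 0 * x 1] twists [K[x3]] by [tau \o sigma]; crossing it with [x 1] or [x 0] costs
    a factor [q] or [q^-1], and [x 1 * x 0 = q x 0 x 1] is its image under [sigma']. *)
Lemma nf_skew_gwa : q != 0 -> c = 0 -> b = 0 ->
  let D := skew_poly (tau \o sigma) in
  let h : D := pgen tt in
  exists (sigma' tau' : {rmorphism D -> D}) (j : D -> A),
    [/\ (forall p, sigma' (pcst p) = pcst (sigma p)) /\
        sigma' h = pcst q%:P * h,
        (forall p, tau' (pcst p) = pcst (tau p)) /\
        tau' h = pcst (q^-1)%:P * h,
        (forall p, j (pcst p) = ev p) /\ j h = x 0 * x 1
      & is_gwa sigma' tau' h j (x 1) (x 0)].
Proof.
move=> q0 c0 b0 D h.
have [f [fE fC fX]] := nf_evalP q al mu c b.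
have hE p : h * pcst p = pcst (tau (sigma p)) * h by apply: skewE.
have hC k : h * pcst k%:P = pcst k%:P * h by rewrite hE sigmaP.1 tauP.1.
have [p|s [sc sh]] :=
  @skew_liftP _ D (pcst \o sigma) (tau \o sigma) (pcst q%:P * h).
  by rewrite /= -mulrA hE !mulrA -!rmorphM shiftsC mulrC.
have [p|t [tc th]] :=
  @skew_liftP _ D (pcst \o tau) (tau \o sigma) (pcst (q^-1)%:P * h).
  by rewrite /= -mulrA hE !mulrA -!rmorphM shiftsC mulrC.
have [p|j [jc jh]] := @skew_liftP _ _ f (tau \o sigma) (x 0 * x 1).
  by rewrite -mulrA !fE nf_x1_eval mulrA nf_x0_eval mulrA.
have tsh : t (s h) = h.
  rewrite sh rmorphM tc th /= tauP.1 mulrA -!rmorphM.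
  by rewrite mulfV // !rmorph1 mul1r.
have sth : s (t h) = h.
  rewrite th rmorphM sc sh /= sigmaP.1 mulrA -!rmorphM.
  by rewrite mulVf // !rmorph1 mul1r.
have hx : x 1 * x 0 = pcst q * x 0 * x 1.
  by rewrite nf_x1x0 c0 b0 !rmorph0 mul0r !addr0.
have x1j d : x 1 * j d = j (s d) * x 1.
  apply: (@pres_twist _ _ _ _ j (j \o s)) => [p|[]] /=.
    by rewrite sc !jc !fE nf_x1_eval.
  by rewrite sh rmorphM !jc !jh fC mulrA hx !mulrA.
have x0j d : x 0 * j d = j (t d) * x 0.
  apply: (@pres_twist _ _ _ _ j (j \o t)) => [p|[]] /=.
    by rewrite tc !jc !fE nf_x0_eval.
  rewrite th rmorphM !jc !jh fC -!mulrA hx -[pcst q * _ * _]mulrA.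
  rewrite [x 0 * (pcst q * _)]mulrA nfxC !mulrA -rmorphM mulVf //.
  by rewrite rmorph1 mul1r.
exists s, t, j; split=> //; first by split=> [p|]; rewrite ?jc ?fE.
split.
  split=> // d; split.
    apply: (@pres_twist _ _ _ _ idfun (t \o s)) => [p|[]] /=.
      by rewrite sc tc hE.
    by rewrite tsh.
  apply: (@pres_twist _ _ _ _ idfun (s \o t)) => [p|[]] /=.
    rewrite sh tc sc /= -mulrA hE !mulrA -!rmorphM shiftsC mulrC //.
  by rewrite sth sh mulrA hC.
have [||F [Fc FX FY]] := @gwa_liftP _ _ _ _ _ h _ _ x1j x0j.
- by rewrite jh.
- by rewrite sh rmorphM jc jh fC hx mulrA.
have [k|k|k||||G [Gc G0 G1 G2]] := @nf_liftP _ q al mu c b (gwa s t h)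
  (pcst \o pcst \o polyC) (pgen gY) (pgen gX) (pcst (pcst 'X)).
- by rewrite /= gwaYE tc /= tauP.1.
- by rewrite /= gwaXE sc /= sigmaP.1.
- by rewrite /= -!rmorphM mulrC.
- by rewrite /= -mulrA gwaYXE gwaXYE sh c0 b0 !rmorphM !rmorph0 mul0r !addr0.
- by rewrite /= -!rmorphD gwaYE tc /= rmorphD tauP.1 tauP.2 subrK.
- by rewrite /= -!rmorphD gwaXE sc /= rmorphD sigmaP.1 sigmaP.2 subrK.
have Gf : G \o f =1 pcst \o pcst.
  by apply: poly_ext => [k|] /=; [rewrite fC Gc|rewrite fX G2].
have Gj : G \o j =1 pcst.
  apply: pres_ext => [p|[]] /=; first by rewrite jc; apply: Gf.
  by rewrite jh rmorphM G0 G1 gwaYXE.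
exists F; split=> //.
exists G => u.
  rewrite -[LHS]/((G \o F) u) -[RHS]/(idfun u).
  by apply: pres_ext => [d|[]] /=; rewrite ?FX ?FY ?G0 ?G1 // Fc; apply: Gj.
rewrite -[LHS]/((F \o G) u) -[RHS]/(idfun u).
by apply: nf_ext => [k|||] /=; rewrite ?Gc ?G0 ?G1 ?G2 //= Fc ?jc ?fC ?fX.
Qed.

End NormalFormStructure.

(** * The classical generalized Weyl algebra over [K[x3, h]] *)

Section NormalFormClassicalGWA.
Variables (K : fieldType) (q al mu c b : K).
Local Notation A := (nf q al mu c b).
Local Notation x := (nfx q al mu c b).
Local Notation ev := (nf_eval q al mu c b).
Local Notation D := {poly {poly K}}.

Lemma bipoly_ext (R : pzRingType) (F G : {rmorphism D -> R}) :
  (forall k : K, F k%:P%:P = G k%:P%:P) -> F 'X%:P = G 'X%:P -> F 'X = G 'X ->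
  F =1 G.
Proof.
move=> FGk FG3 FGh; apply: poly_ext => // p.
rewrite -[LHS]/((F \o polyC) p) -[RHS]/((G \o polyC) p).
exact: poly_ext.
Qed.

Lemma bipoly_endoP (u v : D) : exists s : {rmorphism D -> D},
  [/\ forall k : K, s k%:P%:P = k%:P%:P, s 'X%:P = u & s 'X = v].
Proof.
have [s0 [_ s0C s0X]] :=
  @pevalP K D (polyC \o polyC) u (fun k => mulrC _ _).
have [s [_ sC sX]] := @pevalP {poly K} D s0 v (fun k => mulrC _ _).
by exists s; split=> // [k|]; rewrite sC.
Qed.

(** For [mu = - al] the shifts by [x 0] and [x 1] are inverse to each other, so [x 0 * x 1] commutes
    with [x 2] and the base ring is commutative; [h] is its outer variable. The first defining
    relation reads [x 1 * x 0 = sigma h]. *)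
Lemma nf_classical_gwa : q != 0 -> mu = - al ->
  let x3 : D := 'X%:P in
  let h : D := 'X in
  exists (sigma : {rmorphism D -> D}) (j : D -> A),
    [/\ forall k : K, sigma k%:P%:P = k%:P%:P,
        sigma x3 = x3 + al%:P%:P,
        sigma h = q%:P%:P * h + c%:P%:P * x3 + b%:P%:P,
        (forall p, j p%:P = ev p) /\ j h = x 0 * x 1
      & is_classical_gwa sigma h j (x 1) (x 0)].
Proof.
move=> q0 mual x3 h.
have [s [sk s3 sh]] := bipoly_endoP (x3 + al%:P%:P)
  (q%:P%:P * h + c%:P%:P * x3 + b%:P%:P).
(* The value of [t] at [h] solves the formula for [s h], with [x3] shifted back. *)
have [t [tk t3 th]] := bipoly_endoP (x3 - al%:P%:P)
  ((q^-1)%:P%:P * (h - c%:P%:P * (x3 - al%:P%:P) - b%:P%:P)).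
have qq : (q^-1)%:P%:P * q%:P%:P = 1 :> D by rewrite -!rmorphM mulVf.
have st : cancel s t.
  move=> d; rewrite -[LHS]/((t \o s) d) -[RHS]/(idfun d).
  apply: bipoly_ext => [k||] /=; first by rewrite sk tk.
    by rewrite s3 rmorphD t3 tk subrK.
  rewrite sh !rmorphD !rmorphM !tk t3 th mulrA [q%:P%:P * _]mulrC qq mul1r.
  by rewrite -/h; ring.
have ts : cancel t s.
  move=> d; rewrite -[LHS]/((s \o t) d) -[RHS]/(idfun d).
  apply: bipoly_ext => [k||] /=; first by rewrite tk sk.
    by rewrite t3 rmorphB s3 sk addrK.
  rewrite th !(rmorphB, rmorphM) !sk s3 sh -/h.
  by rewrite -[RHS]mul1r -qq; ring.
have [f [fE fC fX]] := nf_evalP q al mu c b.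
have [s0 s0P] := poly_endoP ('X - mu%:P).
have [t0 t0P] := poly_endoP ('X - al%:P).
have x0f p : x 0 * f p = f (t0 p) * x 0 by rewrite !fE (nf_x0_eval _ _ _ _ t0P).
have x1f p : x 1 * f p = f (s0 p) * x 1 by rewrite !fE (nf_x1_eval _ _ _ _ s0P).
have ts0 p : t0 (s0 p) = p.
  rewrite -[LHS]/((t0 \o s0) p) -[RHS]/(idfun p).
  apply: poly_ext => [k|] /=; first by rewrite s0P.1 t0P.1.
  by rewrite s0P.2 rmorphB /= t0P.1 t0P.2 mual rmorphN opprK subrK.
have s0E p : s p%:P = (s0 p)%:P.
  rewrite -[LHS]/((s \o polyC) p) -[RHS]/((polyC \o s0) p).
  apply: poly_ext => [k|] /=; first by rewrite s0P.1 sk.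
  by rewrite s3 s0P.2 rmorphB /= mual !rmorphN opprK.
have [p|j [_ jf jh]] := @pevalP _ _ f (x 0 * x 1).
  by rewrite -mulrA x1f mulrA x0f ts0 mulrA.
have hs : x 1 * x 0 = j (s h).
  by rewrite sh !rmorphD !rmorphM /= !jf !fC fX jh nf_x1x0 !mulrA.
have x1j d : x 1 * j d = j (s d) * x 1.
  apply: (@poly_twist _ _ j (j \o s)) => [p|] /=.
    by rewrite s0E !jf x1f.
  by rewrite jh mulrA hs.
have x0j d : x 0 * j d = j (t d) * x 0.
  (* With [d = s (t d)], the case of [h] is associativity of [x 0 * x 1 * x 0]. *)
  rewrite -{1}[d]ts.
  apply: (@poly_twist _ _ (j \o s) j) => [p|] /=.
    by rewrite s0E !jf x0f ts0.
  by rewrite -hs jh mulrA.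
exists s, j; split=> //; first by split=> [p|]; rewrite ?jf ?fE.
exists t; split=> // [d|]; first exact: mulrC.
split.
  split=> // d; rewrite st ts; split; exact: mulrC.
have [||F [Fc FX FY]] := @gwa_liftP _ _ _ _ _ h _ _ x1j x0j.
- by rewrite jh.
- exact: hs.
have [k|k|k||||G [Gc G0 G1 G2]] := @nf_liftP _ q al mu c b (gwa s t h)
  (pcst \o (polyC \o polyC)) (pgen gY) (pgen gX) (pcst x3).
- by rewrite /= gwaYE /= tk.
- by rewrite /= gwaXE /= sk.
- by rewrite /= -!rmorphM mulrC.
- by rewrite /= -mulrA gwaYXE gwaXYE sh !rmorphD !rmorphM.
- by rewrite /= -rmorphD gwaYE rmorphD /= tk t3 subrK.
- by rewrite /= -rmorphD gwaXE rmorphD /= sk s3 mual !rmorphN addrK.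
have Gj : G \o j =1 pcst.
  apply: bipoly_ext => [k||] /=.
  - by rewrite jf fC Gc.
  - by rewrite jf fX G2.
  - by rewrite jh rmorphM G0 G1 gwaYXE.
exists F; split=> //.
exists G => u.
  rewrite -[LHS]/((G \o F) u) -[RHS]/(idfun u).
  by apply: pres_ext => [d|[]] /=; rewrite ?FX ?FY ?G0 ?G1 // Fc; apply: Gj.
rewrite -[LHS]/((F \o G) u) -[RHS]/(idfun u).
by apply: nf_ext => [k|||] /=; rewrite ?Gc ?G0 ?G1 ?G2 //= Fc ?jf ?fC ?fX.
Qed.

End NormalFormClassicalGWA.

(** Exchanging [x 0] and [x 1] inverts the commutation factor; the same exchange in the other
    direction is the inverse. *)
Lemma nf_swap_iso (K : fieldType) (q q' al mu : K) : q * q' = 1 ->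
  swap_iso q al mu q' mu al.
Proof.
move=> qq; have q'q : q' * q = 1 by rewrite mulrC.
have hx (r a b : K) : nfx r a b 0 0 1 * nfx r a b 0 0 0
    = pcst r * nfx r a b 0 0 0 * nfx r a b 0 0 1.
  by rewrite nf_x1x0 !rmorph0 mul0r !addr0.
have lift (r r' a b : K) : r * r' = 1 ->
    exists f : {rmorphism algA r a b -> algA r' b a},
    [/\ forall k, f (pcst k) = pcst k, f (algAx r a b 0) = algAx r' b a 1,
      f (algAx r a b 1) = algAx r' b a 0 & f (algAx r a b 2) = algAx r' b a 2].
  move=> rr'; apply: nf_liftP; try by move=> k; apply: nfxC.
  - rewrite !rmorph0 mul0r !addr0 -mulrA hx !mulrA -rmorphM rr'.
    by rewrite rmorph1 mul1r.
  - exact: nf_x2x1.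
  - exact: nf_x2x0.
have [f [fk f0 f1 f2]] := lift q q' al mu qq.
have [g [gk g0 g1 g2]] := lift q' q mu al q'q.
exists f; split=> //.
  by move=> k u; rewrite -[k *: u]/(pcst k * u) rmorphM fk.
exists g => u.
  rewrite -[LHS]/((g \o f) u) -[RHS]/(idfun u).
  by apply: nf_ext => [k|||] /=; rewrite ?fk ?f0 ?f1 ?f2.
rewrite -[LHS]/((f \o g) u) -[RHS]/(idfun u).
by apply: nf_ext => [k|||] /=; rewrite ?gk ?g0 ?g1 ?g2.
Qed.

(** * Regularity and normality *)

Section PresentedModule.
Variables (D : pzRingType) (I : Type) (E : rterm D I -> rterm D I -> Prop).
Variables (V : zmodType) (c : D -> V -> V) (g : I -> V -> V).
Hypothesis gD : forall i, {morph g i : v w / v + w}.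
Hypothesis cB : forall d, {morph c d : v w / v + w}.
Hypothesis cD : forall d e v, c (d + e) v = c d v + c e v.
Hypothesis cM : forall d e v, c (d * e) v = c d (c e v).
Hypothesis c1 : forall v, c 1 v = v.

Fixpoint act (t : rterm D I) (v : V) : V :=
  match t with
  | TCst d => c d v
  | TGen i => g i v
  | TAdd s t => act s v + act t v
  | TOpp s => - act s v
  | TMul s t => act s (act t v)
  end.

Lemma actD t : {morph act t : v w / v + w}.
Proof.
elim: t => [d|i|s IHs t IHt|s IHs|s IHs t IHt] v w /=.
- exact: cB.
- exact: gD.
- by rewrite IHs IHt addrACA.
- by rewrite IHs opprD.
- by rewrite IHt IHs.
Qed.

Hypothesis actE : forall s t, E s t -> act s =1 act t.

Lemma act_cong s t : rcong E s t -> act s =1 act t.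
Proof.
have c0 v : c 0 v = 0 by apply: (addrI (c 0 v)); rewrite -cD !addr0.
elim=> {s t} /=.
- exact: actE.
- by [].
- by move=> s t _ st v; rewrite st.
- by move=> s t u _ st _ tu v; rewrite st tu.
- by move=> s s' t t' _ ss' _ tt' v /=; rewrite ss' tt'.
- by move=> s s' _ ss' v /=; rewrite ss'.
- by move=> s s' t t' _ ss' _ tt' v /=; rewrite tt' ss'.
- by move=> d e v /=.
- by move=> d e v /=.
- by move=> s t u v /=; rewrite addrA.
- by move=> s t v /=; rewrite addrC.
- by move=> s v /=; rewrite c0 add0r.
- by move=> s v /=; rewrite addNr c0.
- by [].
- by move=> s v /=.
- by move=> s v /=; rewrite c1.
- by [].
- by move=> s t u v /=; rewrite actD.
Qed.

(** By equivariance [psi (act t v0)] is the class of [t], so [act t v0] determines this class.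
    Cancelling [pgen i] thus reduces to cancelling the injective operator [g i] on [V]. *)
Lemma pres_lreg (psi : {additive V -> pres E}) (v0 : V) (i : I) :
  (forall d v, psi (c d v) = pcst d * psi v) ->
  (forall j v, psi (g j v) = pgen j * psi v) ->
  psi v0 = 1 -> injective (g i) -> GRing.lreg (pgen i : pres E).
Proof.
move=> psic psig psi1 g_inj.
have psiA t v : psi (act t v) = rt_eval pcst pgen t * psi v.
  elim: t v => [d|j|s IHs t IHt|s IHs|s IHs t IHt] v //=.
  - by rewrite raddfD /= IHs IHt mulrDl.
  - by rewrite raddfN /= IHs mulNr.
  - by rewrite IHs IHt mulrA.
elim/presW=> s; elim/presW=> t; rewrite -!rt_eval_pi => st.
suff st0 : act s v0 = act t v0.
  by rewrite -[LHS]mulr1 -[RHS]mulr1 -psi1 -!psiA st0.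
apply: g_inj; rewrite -[LHS]/(act (TGen i * s)%RT v0).
apply: (@act_cong (TGen i * s)%RT (TGen i * t)%RT).
by apply/pres_eqP; rewrite -!rt_eval_pi.
Qed.

End PresentedModule.

Section TriPoly.
Variable K : fieldType.
Local Notation V := {poly {poly {poly K}}}.

Lemma tripoly_ext (R : pzRingType) (F G : {rmorphism V -> R}) :
  (forall k : K, F k%:P%:P%:P = G k%:P%:P%:P) ->
  F 'X%:P%:P = G 'X%:P%:P -> F 'X%:P = G 'X%:P -> F 'X = G 'X -> F =1 G.
Proof.
move=> FGk FG2 FG0 FG1; apply: poly_ext => // p.
rewrite -[LHS]/((F \o polyC) p) -[RHS]/((G \o polyC) p).
exact: bipoly_ext.
Qed.

Lemma tripoly_endoP (s u : K) : exists F : {rmorphism V -> V},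
  [/\ forall k : K, F k%:P%:P%:P = k%:P%:P%:P,
      F 'X%:P%:P = 'X%:P%:P + s%:P%:P%:P,
      F 'X%:P = u%:P%:P%:P * 'X%:P & F 'X = 'X].
Proof.
have [F0 [_ F0k F0Z]] := @pevalP _ V (polyC \o (polyC \o polyC))
  ('X%:P%:P + s%:P%:P%:P) (fun k => mulrC _ _).
have [F1 [_ F1p F1X]] :=
  @pevalP _ _ F0 (u%:P%:P%:P * 'X%:P) (fun k => mulrC _ _).
have [F [_ Fp FY]] := @pevalP _ _ F1 'X (fun k => mulrC _ _).
by exists F; split=> // [k||]; rewrite !Fp ?F1p ?F0k.
Qed.

(** The substitution with parameters [- s] and [u^-1] is a left inverse. *)
Lemma tripoly_endo_inj (s u : K) (F : {rmorphism V -> V}) : u != 0 ->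
  (forall k : K, F k%:P%:P%:P = k%:P%:P%:P) ->
  F 'X%:P%:P = 'X%:P%:P + s%:P%:P%:P -> F 'X%:P = u%:P%:P%:P * 'X%:P ->
  F 'X = 'X -> injective F.
Proof.
move=> u0 Fk FZ FX FY; have [G [Gk GZ GX GY]] := tripoly_endoP (- s) u^-1.
apply: (can_inj (g := G)) => v; rewrite -[LHS]/((G \o F) v) -[RHS]/(idfun v).
apply: tripoly_ext => [k|||] /=; first by rewrite Fk Gk.
- by rewrite FZ rmorphD GZ Gk !rmorphN subrK.
- by rewrite FX rmorphM Gk GX mulrA -!rmorphM divff // !rmorph1 mul1r.
- by rewrite FY GY.
Qed.

End TriPoly.

Section NormalFormRegular.
Variables (K : fieldType) (q al mu : K).
Hypothesis q0 : q != 0.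
Local Notation A := (algA q al mu).
Local Notation x := (algAx q al mu).
Local Notation V := {poly {poly {poly K}}}.

Lemma algA_x1x0 : x 1 * x 0 = pcst q * x 0 * x 1.
Proof. by rewrite nf_x1x0 !rmorph0 mul0r !addr0. Qed.

Lemma algA_x1x0n n : x 1 * x 0 ^+ n = pcst (q ^+ n) * x 0 ^+ n * x 1.
Proof.
elim: n => [|n IHn]; first by rewrite !expr0 rmorph1 !mulr1 mul1r.
rewrite !exprSr mulrA IHn -!mulrA algA_x1x0 rmorphM -!mulrA; congr (_ * _).
rewrite !mulrA; congr (_ * _ * _).
elim: n {IHn} => [|n IHn]; first by rewrite expr0 mulr1 mul1r.
by rewrite exprSr mulrA -IHn -!mulrA nfxC.
Qed.

(* The normal word x3^k x1^i x2^j is encoded in [V] as                        *)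
(* 'X%:P%:P ^+ k * 'X%:P ^+ i * 'X ^+ j; as x_i p(x3) = (tau p)(x3) x_i, left *)
(* multiplication by x1 and x2 is a substitution followed by a product.       *)
Lemma algA_lreg (i : 'I_3) : GRing.lreg (x i).
Proof.
have [t [tk tZ tX tY]] := tripoly_endoP (- al) 1.
have [s [sk sZ sX sY]] := tripoly_endoP (- mu) q.
(* This makes the operators satisfy the relation between [x 1] and [x 0]. *)
have st v : s (t v) = t (s v).
  rewrite -[LHS]/((s \o t) v) -[RHS]/((t \o s) v).
  apply: tripoly_ext => [k|||] /=; first by rewrite sk tk.
  - by rewrite tZ sZ !rmorphD tZ sZ tk sk addrAC.
  - by rewrite tX sX !rmorphM tX sX tk sk mulrCA.
  - by rewrite tY sY.
pose c (k : K) (v : V) : V := k%:P%:P%:P * v.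
pose g (j : 'I_3) : V -> V := nth id
  [:: (fun v => 'X%:P * t v); (fun v => 'X * s v); (fun v => 'X%:P%:P * v)] j.
have cB d : {morph c d : v w / v + w} by move=> v w; rewrite /c mulrDr.
have cD d e v : c (d + e) v = c d v + c e v by rewrite /c !rmorphD mulrDl.
have cM d e v : c (d * e) v = c d (c e v) by rewrite /c !rmorphM mulrA.
have c1 v : c 1 v = v by rewrite /c !rmorph1 mul1r.
have gD j : {morph g j : v w / v + w}.
  by elim/ord3P: j => v w; rewrite /g /= ?rmorphD mulrDr.
have gE u v : bq_rel (nf_Q q) (nf_M al mu 0) (nf_B 0) u v ->
    act c g u =1 act c g v.
  case=> [k j|||] w /=.
  - elim/ord3P: j; rewrite /g /c /= ?rmorphM ?tk ?sk; ring.
  - rewrite /g /c /= !nfE /= !rmorphM sX tY st; ring.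
  - rewrite /g /c /= !nfE /= !rmorphM tZ !rmorphE; ring.
  - rewrite /g /c /= !nfE /= !rmorphM sZ !rmorphE; ring.
have g_inj : injective (g i).
  elim/ord3P: i; rewrite /g /= => v w.
  - move/mulfI => tvw; apply/(tripoly_endo_inj (oner_neq0 K) tk tZ tX tY)/tvw.
    by rewrite polyC_eq0 polyX_eq0.
  - by move/(mulfI (negbT (polyX_eq0 _)))/(tripoly_endo_inj q0 sk sZ sX sY).
  - by move/mulfI; apply; rewrite !polyC_eq0 polyX_eq0.
have [f [fE fC fX]] := nf_evalP q al mu 0 0.
(* [psi] decodes normal words. It is additive only, so its equivariance is checked on monomials. *)
pose psi0 : {additive {poly {poly K}} -> A} := leval f (fun i => x 0 ^+ i).
pose psi : {additive V -> A} := leval psi0 (fun j => x 1 ^+ j).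
have psiE p m n : psi ((p%:P * 'X^m)%:P * 'X^n) = f p * x 0 ^+ m * x 1 ^+ n.
  by rewrite /psi /= levalCXn /= levalCXn.
have psi_ext (F G : V -> A) :
    {morph F : v w / v + w} -> {morph G : v w / v + w} ->
    (forall p m n, F ((p%:P * 'X^m)%:P * 'X^n) = G ((p%:P * 'X^m)%:P * 'X^n)) ->
  F =1 G.
  move=> FD GD FG; apply: poly_additive_ext => // u n.
  apply: (@poly_additive_ext _ _
    (fun u => F (u%:P * 'X^n)) (fun u => G (u%:P * 'X^n))).
  - by move=> u1 u2; rewrite rmorphD mulrDl FD.
  - by move=> u1 u2; rewrite rmorphD mulrDl GD.
  - by move=> p m; apply: FG.
apply: (@pres_lreg _ _ _ _ c g gD cB cD cM c1 gE psi 1 i) => //.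
- move=> d; apply: (psi_ext (fun v => psi (c d v)) (fun v => pcst d * psi v)).
  + by move=> v w; rewrite cB raddfD.
  + by move=> v w; rewrite raddfD mulrDr.
  + move=> p m n; have -> : c d ((p%:P * 'X^m)%:P * 'X^n)
        = ((d%:P * p)%:P * 'X^m)%:P * 'X^n by rewrite /c !rmorphM !mulrA.
    by rewrite !psiE rmorphM fC !mulrA.
- have [s0 s0P] := poly_endoP ('X - mu%:P).
  have [t0 t0P] := poly_endoP ('X - al%:P).
  have s0E p : s p%:P%:P = (s0 p)%:P%:P.
    rewrite -[LHS]/((s \o (polyC \o polyC)) p).
    rewrite -[RHS]/((polyC \o (polyC \o s0)) p).
    apply: poly_ext => [k|] /=; first by rewrite sk s0P.1.
    by rewrite sZ s0P.2 !(rmorphB, rmorphN).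
  have t0E p : t p%:P%:P = (t0 p)%:P%:P.
    rewrite -[LHS]/((t \o (polyC \o polyC)) p).
    rewrite -[RHS]/((polyC \o (polyC \o t0)) p).
    apply: poly_ext => [k|] /=; first by rewrite tk t0P.1.
    by rewrite tZ t0P.2 !(rmorphB, rmorphN).
  have x0f p : x 0 * f p = f (t0 p) * x 0.
    by rewrite !fE (nf_x0_eval _ _ _ _ t0P).
  have x1f p : x 1 * f p = f (s0 p) * x 1.
    by rewrite !fE (nf_x1_eval _ _ _ _ s0P).
  move=> j; apply: (psi_ext (fun v => psi (g j v)) (fun v => x j * psi v)).
  + by move=> v w; rewrite gD raddfD.
  + by move=> v w; rewrite raddfD mulrDr.
  move=> p m n; elim/ord3P: j; rewrite /g /=.
  + have -> : 'X%:P * t ((p%:P * 'X^m)%:P * 'X^n)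
        = (((t0 p)%:P * 'X^(m.+1))%:P * 'X^n).
      rewrite !rmorphM /= !rmorphXn /= t0E tX tY !rmorph1 mul1r exprS.
      ring.
    rewrite !psiE !mulrA x0f.
    by rewrite exprS !mulrA.
  + have -> : 'X * s ((p%:P * 'X^m)%:P * 'X^n)
        = (((s0 p * (q ^+ m)%:P)%:P * 'X^m)%:P * 'X^(n.+1)).
      rewrite !rmorphM /= !rmorphXn /= s0E sX sY exprMn exprS.
      ring.
    rewrite !psiE !mulrA x1f rmorphM fC.
    by rewrite -[f _ * x 1 * _]mulrA algA_x1x0n exprS !mulrA.
  + have -> : 'X%:P%:P * ((p%:P * 'X^m)%:P * 'X^n)
        = ((('X * p)%:P * 'X^m)%:P * 'X^n) by rewrite !rmorphM !mulrA.
    by rewrite !psiE rmorphM fX !mulrA.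
- by have := psiE 1 0 0; rewrite !expr0 !rmorph1 !mulr1.
Qed.
End NormalFormRegular.

(** As [u r = F (G u) r = r (G u)], right and left multiplication by [r] differ by a bijection. *)
Lemma twisted_regular_normal (R : pzRingType) (r : R) (F G : R -> R) :
  cancel F G -> cancel G F -> (forall u, r * u = F u * r) -> GRing.lreg r ->
  regular r /\ normal_elt r.
Proof.
move=> FG GF rF rl; split; first split=> // u v.
  by rewrite -[u]GF -[v]GF -!rF => /rl ->.
move=> z; split=> [[u ->]|[u ->]]; last by exists (F u).
by exists (G u); rewrite rF GF.
Qed.

Lemma regular_normalM (R : pzRingType) (r s : R) :
  regular r /\ normal_elt r -> regular s /\ normal_elt s ->
  regular (r * s) /\ normal_elt (r * s).
Proof.
move=> [[rl rr] rn] [[sl sr] sn]; split.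
  split=> u v; first by rewrite -!mulrA => /rl/sl.
  by rewrite !mulrA => /sr/rr.
move=> z; split=> [[u ->]|[u ->]].
  have [v uv] : exists v, u * r = r * v by apply/rn; exists u.
  have [w vw] : exists w, v * s = s * w by apply/sn; exists v.
  by exists w; rewrite mulrA uv -mulrA vw mulrA.
have [v uv] : exists v, s * u = v * s by apply/sn; exists u.
have [w vw] : exists w, r * v = w * r by apply/rn; exists v.
by exists w; rewrite -mulrA uv mulrA vw -mulrA.
Qed.

Section NormalFormNormal.
Variables (K : fieldType) (q al mu : K).
Hypothesis q0 : q != 0.
Local Notation A := (algA q al mu).
Local Notation x := (algAx q al mu).

(** These include conjugation by [x 0] and by [x 1]. The relations are homogeneous in [x 0] and
    [x 1], and a translation of [x 2] preserves them. *)
Lemma algA_scale_shift (u v w : K) : exists F : {rmorphism A -> A},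
  [/\ forall k, F (pcst k) = pcst k, F (x 0) = pcst u * x 0,
      F (x 1) = pcst v * x 1 & F (x 2) = x 2 + pcst w].
Proof.
have C i a k : pcst a * x i * pcst k = pcst k * (pcst a * x i).
  by rewrite -mulrA nfxC !mulrA -!rmorphM mulrC.
have C2 k : (x 2 + pcst w) * pcst k = pcst k * (x 2 + pcst w).
  by rewrite mulrDl mulrDr nfxC -!rmorphM mulrC.
apply: nf_liftP => //.
- exact: C.
- exact: C.
- rewrite !rmorph0 mul0r !addr0 mulrA C -!mulrA algA_x1x0 !mulrA -!rmorphM.
  rewrite -[_ * x 0 * pcst v]mulrA nfxC !mulrA -!rmorphM.
  by congr (pcst _ * _ * _); ring.
- rewrite mulrA C2 -!mulrA; congr (_ * _).
  by rewrite mulrDl nf_x2x0 !mulrDr !nfxC addrAC.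
- rewrite mulrA C2 -!mulrA; congr (_ * _).
  by rewrite mulrDl nf_x2x1 !mulrDr !nfxC addrAC.
Qed.

Lemma algA_normal (i : 'I_3) (u v w : K) : u != 0 -> v != 0 ->
  x i * x 0 = pcst u * x 0 * x i -> x i * x 1 = pcst v * x 1 * x i ->
  x i * x 2 = (x 2 + pcst w) * x i ->
  regular (x i) /\ normal_elt (x i).
Proof.
move=> u0 v0 h0 h1 h2.
have [F [Fk F0 F1 F2]] := algA_scale_shift u v w.
have [G [Gk G0 G1 G2]] := algA_scale_shift u^-1 v^-1 (- w).
apply: (@twisted_regular_normal _ _ F G); last exact: algA_lreg.
- move=> z; rewrite -[LHS]/((G \o F) z) -[RHS]/(idfun z).
  apply: nf_ext => [k|||] /=; first by rewrite Fk Gk.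
  + by rewrite F0 rmorphM Gk G0 mulrA -rmorphM divff // rmorph1 mul1r.
  + by rewrite F1 rmorphM Gk G1 mulrA -rmorphM divff // rmorph1 mul1r.
  + by rewrite F2 rmorphD Gk G2 rmorphN subrK.
- move=> z; rewrite -[LHS]/((F \o G) z) -[RHS]/(idfun z).
  apply: nf_ext => [k|||] /=; first by rewrite Gk Fk.
  + by rewrite G0 rmorphM Fk F0 mulrA -rmorphM mulVf // rmorph1 mul1r.
  + by rewrite G1 rmorphM Fk F1 mulrA -rmorphM mulVf // rmorph1 mul1r.
  + by rewrite G2 rmorphD Fk F2 rmorphN addrK.
- apply: (@pres_twist _ _ _ _ idfun F) => [k|]; first by rewrite Fk nfxC.
  by apply: ord3P => /=; rewrite ?F0 ?F1 ?F2.
Qed.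

Lemma algA_x0_normal : regular (x 0) /\ normal_elt (x 0).
Proof.
apply: (@algA_normal 0 1 q^-1 (- al)); rewrite ?oner_neq0 ?invr_eq0 //.
- by rewrite rmorph1 mul1r.
- by rewrite -mulrA algA_x1x0 !mulrA -rmorphM mulVf // rmorph1 mul1r.
- by rewrite nf_x0x2 rmorphN.
Qed.

Lemma algA_x1_normal : regular (x 1) /\ normal_elt (x 1).
Proof.
apply: (@algA_normal 1 q 1 (- mu)); rewrite ?oner_neq0 //.
- exact: algA_x1x0.
- by rewrite rmorph1 mul1r.
- by rewrite nf_x1x2 rmorphN.
Qed.

End NormalFormNormal.

(** * Reduction to the normal forms *)

Section NormalFormReduction.
Variables (K : fieldType) (Q : 'rV[K]_3) (M : 'M[K]_3) (B : 'rV[K]_3).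
Hypotheses (hq1 : Q 0 0 != 1) (hq2 : Q 0 1 = 1) (hq3 : Q 0 2 = 1).

Lemma pbw_coef : pbw Q M B ->
  [/\ [/\ M 2 0 = 0, M 1 1 = 0, M 2 2 = 0 & M 1 2 = 0],
      M 2 1 * M 0 0 + (1 - Q 0 0) * B 0 2 = 0,
      M 1 0 * M 0 1 + (1 - Q 0 0) * B 0 1 = 0,
      (M 1 0 + M 2 1) * M 0 2 = 0
    & (M 1 0 + M 2 1) * B 0 0 - M 0 0 * B 0 1 - M 0 1 * B 0 2 = 0].
Proof.
move=> [_ free]; pose x := bqx Q M B.
have q0 : 1 - Q 0 0 != 0 by rewrite subr_eq0 eq_sym.
have r0 := bqx_rel Q M B 0; have r1 := bqx_rel Q M B 1.
have r2 := bqx_rel Q M B 2; rewrite /= ?hq2 ?hq3 ?rmorph1 ?mul1r in r0 r1 r2.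
move/(canRL (subrK _)): r0; rewrite [RHS]addrC !addrA => r0.
move/(canRL (subrK _)): r1; rewrite [RHS]addrC !addrA => r1.
move/(canRL (subrK _)): r2; rewrite [RHS]addrC !addrA => r2.
have free8 (c0 c1 c2 c3 c4 c5 c6 c7 : K) :
    pcst c0 * (x 0 * x 0) + pcst c1 * (x 1 * x 1) + pcst c2 * (x 0 * x 2)
    + pcst c3 * (x 1 * x 2) + pcst c4 * x 0 + pcst c5 * x 1 + pcst c6 * x 2
    + pcst c7 = 0 ->
    [/\ [/\ c0 = 0, c1 = 0, c2 = 0 & c3 = 0], c4 = 0, c5 = 0, c6 = 0 & c7 = 0].
  move=> E; pose s := [:: (2, 0, 0); (0, 2, 0); (1, 0, 1); (0, 1, 1);
    (1, 0, 0); (0, 1, 0); (0, 0, 1); (0, 0, 0)]%N.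
  pose k t := [:: c0; c1; c2; c3; c4; c5; c6; c7]`_(index t s).
  have {}E : forall t, t \in s -> k t = 0.
    apply: (free s k) => //; rewrite -[RHS]E /s !big_cons big_nil addr0 /k /=.
    rewrite !expr0 !mulr1 !mul1r !expr2 !addrA /GRing.scale /= /bq_scale.
    by rewrite mulr1.
  by split; first split;
    [apply: (E (2, 0, 0)%N)|apply: (E (0, 2, 0)%N)|apply: (E (1, 0, 1)%N)
    |apply: (E (0, 1, 1)%N)|apply: (E (1, 0, 0)%N)|apply: (E (0, 1, 0)%N)
    |apply: (E (0, 0, 1)%N)|apply: (E (0, 0, 0)%N)].
have xC := @bqxC K Q M B.
have [[/eqP h20 /eqP h11 /eqP h22 /eqP h12] h4 h5 h6 h7] :=
  free8 _ _ _ _ _ _ _ _ (overlap_relation (xC 0) (xC 1) (xC 2) r0 r1 r2).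
rewrite !mulf_eq0 !(negPf q0) !orbF in h20 h11 h22 h12.
move/eqP: h20 h4 h5 h6 h7 => ->; move/eqP: h11 => ->; move/eqP: h22 => ->.
move/eqP: h12 => -> h4 h5 h6 h7; split=> //.
- by rewrite -h4; ring.
- by rewrite -h5; ring.
- by rewrite -h6; ring.
- by rewrite -h7; ring.
Qed.

(* The substitution x1 -> x1 + s, x2 -> x2 + t removes the terms in x1 and x2 *)
(* from the first relation.                                                   *)
Lemma G3_nf (s t l0 l1 l2 m2 al mu c b : K) :
  M 2 0 = 0 -> M 1 1 = 0 -> M 2 2 = 0 -> M 1 2 = 0 ->
  M 0 1 = (Q 0 0 - 1) * s -> M 0 0 = (Q 0 0 - 1) * t ->
  B 0 1 = M 1 0 * s -> B 0 2 = M 2 1 * t ->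
  l0 != 0 -> l1 != 0 -> l2 != 0 -> al = l2 * M 1 0 -> mu = l2 * M 2 1 ->
  c * l2 = l0 * l1 * M 0 2 ->
  b + c * m2 = l0 * l1 * (B 0 0 + (1 - Q 0 0) * s * t) ->
  G3_equiv Q M B (nf_Q (Q 0 0)) (nf_M al mu c) (nf_B b).
Proof.
move=> h20 h11 h22 h12 h01 h00 k1 k2 n0 n1 n2 alE muE cE bE.
have -> : nf_Q (Q 0 0) = Q.
  by apply/rowP=> i; rewrite nf_QE; elim/ord3P: i; rewrite ?hq2 ?hq3.
apply: (@G3_equivI _ _ _ _ _ _ (fun i => [:: l0; l1; l2]`_i)
  (fun i => [:: l0 * s; l1 * t; m2]`_i)).
- by elim/ord3P.
- elim/ord3P; elim/ord3P;
    rewrite !nfE /= ?hq2 ?hq3 ?h20 ?h11 ?h22 ?h12 ?h01 ?h00 ?alE ?muE ?cE; ring.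
- elim/ord3P; rewrite !nfE /= ?hq2 ?hq3 ?k1 ?k2 ?alE ?muE; try ring.
  by rewrite !mul0r !add0r addrC bE; ring.
Qed.

End NormalFormReduction.

(** After the translation by [s] and [t], the constant term is killed by [alpha + mu], hence zero.
    Scaling [x3] makes [alpha] equal to 1 or, if [alpha = 0], makes [mu] equal to 1. *)
Lemma G3_nf_generic (K : fieldType) (Q : 'rV[K]_3) (M : 'M[K]_3)
    (B : 'rV[K]_3) :
  Q 0 0 != 1 -> Q 0 1 = 1 -> Q 0 2 = 1 -> pbw Q M B -> M 2 1 + M 1 0 != 0 ->
  exists al mu : K, ((al = 1 /\ mu != -1) \/ (al = 0 /\ mu = 1)) /\
    G3_equiv Q M B (nf_Q (Q 0 0)) (nf_M al mu 0) (nf_B 0).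
Proof.
move=> hq1 hq2 hq3 /(pbw_coef hq1 hq2 hq3) [[h20 h11 h22 h12] e0 e1 e2 e3] am0.
have q0 : Q 0 0 - 1 != 0 by rewrite subr_eq0.
pose s := M 0 1 / (Q 0 0 - 1); pose t := M 0 0 / (Q 0 0 - 1).
have h01 : M 0 1 = (Q 0 0 - 1) * s by rewrite mulrC divfK.
have h00 : M 0 0 = (Q 0 0 - 1) * t by rewrite mulrC divfK.
have k1 : B 0 1 = M 1 0 * s.
  apply: (mulfI q0); apply/eqP; rewrite -subr_eq0 -oppr_eq0 -e1 h01.
  by apply/eqP; ring.
have k2 : B 0 2 = M 2 1 * t.
  apply: (mulfI q0); apply/eqP; rewrite -subr_eq0 -oppr_eq0 -e0 h00.
  by apply/eqP; ring.
have c0 : M 0 2 = 0.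
  by apply/eqP; move/eqP: e2; rewrite mulf_eq0 addrC (negPf am0).
have b0 : B 0 0 + (1 - Q 0 0) * s * t = 0.
  apply/eqP; move: am0; apply: contraNT => b0.
  apply/eqP/(mulIf b0); rewrite mul0r -e3 k1 k2 h01 h00; ring.
have [al0|al0] := eqVneq (M 1 0) 0.
  have mu0 : M 2 1 != 0 by rewrite al0 addr0 in am0.
  exists 0, 1; split; first by right.
  apply: (@G3_nf _ _ _ _ hq2 hq3 s t 1 1 (M 2 1)^-1 0);
    rewrite ?oner_neq0 ?invr_eq0 //.
  - by rewrite al0 mulr0.
  - by rewrite mulVf.
  - by rewrite c0 mul0r mulr0.
  - by rewrite b0 mul0r addr0 mulr0.
exists 1, ((M 1 0)^-1 * M 2 1); split.
  left; split=> //; apply: contraNneq am0 => h.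
  by rewrite -[M 2 1](mulVKf al0) h mulrN1 addNr.
apply: (@G3_nf _ _ _ _ hq2 hq3 s t 1 1 (M 1 0)^-1 0);
  rewrite ?oner_neq0 ?invr_eq0 //.
- by rewrite mulVf.
- by rewrite c0 mul0r mulr0.
- by rewrite b0 mul0r addr0 mulr0.
Qed.

(** The value of [al] separates case (a) from the others, and the pairs [(c, b)] of cases (b) and
    (c) are disjoint. *)
Lemma case2_exactly_one (K : fieldType) (al c b : K) :
  [\/ case2a al c b, case2b al c b | case2c al c b] ->
  exactly_one (case2a al c b) (case2b al c b) (case2c al c b).
Proof.
have n01 : (0 : K) <> 1 by apply/eqP; rewrite eq_sym oner_neq0.
have ab : case2a al c b -> ~ case2b al c b by case=> -> _ _ [].
have ac : case2a al c b -> ~ case2c al c b by case=> -> _ _ [[]|[]].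
have bc : case2b al c b -> ~ case2c al c b.
  case=> _; rewrite !inE => /orP[] /eqP[-> ->] [[_ h1 h2]|[_ h1 h2]] //.
  - exact: (n01 (esym h1)).
  - by rewrite eqxx in h2.
move=> [h|h|h].
- by constructor 1; split=> //; [apply: ab|apply: ac].
- by constructor 2; split=> // [/ab|]; [apply|apply: bc].
- by constructor 3; split=> // [/ac|/bc]; apply.
Qed.

Lemma case2_compact (K : fieldType) (al c b : K) :
  [\/ case2a al c b, case2b al c b | case2c al c b] <->
  [/\ al \in [:: 0; 1], c \in [:: 0; 1] & b \in [:: 0; 1]] \/
  [/\ al = 1, c = 1 & (b != 0) && (b != 1)].
Proof.
rewrite /case2a /case2b /case2c !inE; split.
  case=> [[-> -> ->]|[->]|[[-> -> ->]|[-> -> b1]]]; rewrite ?eqxx ?orbT.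
  - by left.
  - by case/orP=> /eqP[-> ->]; left; rewrite !eqxx ?orbT.
  - by left.
  - by have [->|b0] := eqVneq b 0; [left; rewrite ?eqxx ?orbT|right].
case=> [[/orP[/eqP al0|/eqP al1] c01 b01]|[-> -> /andP[b0 b1]]].
- by constructor 1.
- move: c01 b01 => /orP[/eqP->|/eqP->] /orP[/eqP->|/eqP->].
  + by constructor 2; rewrite eqxx.
  + by constructor 3; left.
  + by constructor 3; right; rewrite eq_sym oner_neq0.
  + by constructor 2; rewrite eqxx orbT.
- by constructor 3; right.
Qed.

(** Scaling [x3] brings [alpha] to 0 or 1; scaling [x1] then brings [c] to 1, or the constant to 0
    or 1 when [c = 0]. *)
Lemma G3_nf_classical (K : fieldType) (Q : 'rV[K]_3) (M : 'M[K]_3)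
    (B : 'rV[K]_3) :
  Q 0 0 != 1 -> Q 0 1 = 1 -> Q 0 2 = 1 -> pbw Q M B -> M 2 1 + M 1 0 = 0 ->
  exists al c b : K, [\/ case2a al c b, case2b al c b | case2c al c b] /\
    G3_equiv Q M B (nf_Q (Q 0 0)) (nf_M al (- al) c) (nf_B b).
Proof.
move=> hq1 hq2 hq3 /(pbw_coef hq1 hq2 hq3) [[h20 h11 h22 h12] e0 e1 _ _] am0.
have q0 : Q 0 0 - 1 != 0 by rewrite subr_eq0.
pose s := M 0 1 / (Q 0 0 - 1); pose t := M 0 0 / (Q 0 0 - 1).
have h01 : M 0 1 = (Q 0 0 - 1) * s by rewrite mulrC divfK.
have h00 : M 0 0 = (Q 0 0 - 1) * t by rewrite mulrC divfK.
have k1 : B 0 1 = M 1 0 * s.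
  apply: (mulfI q0); apply/eqP; rewrite -subr_eq0 -oppr_eq0 -e1 h01.
  by apply/eqP; ring.
have k2 : B 0 2 = M 2 1 * t.
  apply: (mulfI q0); apply/eqP; rewrite -subr_eq0 -oppr_eq0 -e0 h00.
  by apply/eqP; ring.
have muE : M 2 1 = - M 1 0 by apply/eqP; rewrite -addr_eq0 am0.
pose b := B 0 0 + (1 - Q 0 0) * s * t.
have red l0 l2 m2 al c b' : l0 != 0 -> l2 != 0 -> al = l2 * M 1 0 ->
    c * l2 = l0 * M 0 2 -> b' + c * m2 = l0 * b ->
    [\/ case2a al c b', case2b al c b' | case2c al c b'] ->
    exists al c b : K, [\/ case2a al c b, case2b al c b | case2c al c b] /\
      G3_equiv Q M B (nf_Q (Q 0 0)) (nf_M al (- al) c) (nf_B b).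
  move=> l00 l20 alE cE bE h; exists al, c, b'; split=> //.
  apply: (@G3_nf _ _ _ _ hq2 hq3 s t l0 1 l2 m2); rewrite ?oner_neq0 ?mulr1 //.
  by rewrite muE mulrN alE.
have [l2 [al [l20 alE al01]]] :
    exists l2 al, [/\ l2 != 0, al = l2 * M 1 0 & al \in [:: 0; 1]].
  have [al0|al0] := eqVneq (M 1 0) 0.
    by exists 1, 0; rewrite oner_neq0 al0 mulr0 inE eqxx.
  by exists (M 1 0)^-1, 1; rewrite invr_eq0 al0 mulVf // !inE eqxx orbT.
have [c0|c0] := eqVneq (M 0 2) 0.
  have [l0 [b' [l00 bE b01]]] :
      exists l0 b', [/\ l0 != 0, b' = l0 * b & b' \in [:: 0; 1]].
    have [b0|b0] := eqVneq b 0.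
      by exists 1, 0; rewrite oner_neq0 b0 mulr0 inE eqxx.
    by exists b^-1, 1; rewrite invr_eq0 b0 mulVf // !inE eqxx orbT.
  apply: (red l0 l2 0 al 0 b') => //; first by rewrite c0 mulr0 mul0r.
    by rewrite mulr0 addr0.
  by apply/case2_compact; left; split=> //; rewrite inE eqxx.
have l0 : l2 / M 0 2 != 0 by rewrite mulf_neq0 ?invr_eq0.
have cE : 1 * l2 = l2 / M 0 2 * M 0 2 by rewrite divfK ?mul1r.
move: al01; rewrite !inE => /orP[/eqP al0|/eqP al1].
  (* With [c = 1], translating [x3] by the constant term absorbs it. *)
  apply: (red (l2 / M 0 2) l2 (l2 / M 0 2 * b) al 1 0) => //.
    by rewrite mul1r add0r.
  by apply/case2_compact; left; rewrite al0 !inE !eqxx ?orbT.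
(* For [alpha = c = 1] the cases cover every constant, so [x3] is not translated. *)
apply: (red (l2 / M 0 2) l2 0 al 1 (l2 / M 0 2 * b)) => //.
  by rewrite mulr0 addr0.
apply/case2_compact; rewrite al1 !inE.
set b' := _ * b; case: (eqVneq b' 0) => [->|b0].
  by left; rewrite !eqxx ?orbT.
by case: (eqVneq b' 1) => _; [left; rewrite !eqxx ?orbT|right].
Qed.

Theorem theorem1p5 (K : fieldType) (Q : 'rV[K]_3) (M : 'M[K]_3) (B : 'rV[K]_3)
    (hQ : forall i, Q 0 i != 0) (hPBW : pbw Q M B)
    (hq1 : Q 0 0 != 1) (hq2 : Q 0 1 = 1) (hq3 : Q 0 2 = 1) :
  let q1 := Q 0 0 in
  (* mu + alpha != 0 *)
  (M 2 1 + M 1 0 != 0 ->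
    (exists alpha mu : K,
      [/\ (alpha = 1 /\ mu != -1) \/ (alpha = 0 /\ mu = 1),
          G3_equiv Q M B (nf_Q q1) (nf_M alpha mu 0) (nf_B 0)
        & let A := algA q1 alpha mu in
          let x1 : A := algAx q1 alpha mu 0 in
          let x2 : A := algAx q1 alpha mu 1 in
          let ev : {poly K} -> A := nf_eval q1 alpha mu 0 0 in
          [/\ regular x1 /\ normal_elt x1,
              regular x2 /\ normal_elt x2,
              exists sigma tau : {rmorphism {poly K} -> {poly K}},
                [/\ poly_endo tau ('X - alpha%:P),
                    poly_endo sigma ('X - mu%:P),
                    is_diskew sigma tau 0 q1%:P ev x2 x1,
                    tau (sigma 'X) = 'X - alpha%:P - mu%:P
                  & let D := skew_poly (tau \o sigma) in
                    let h : D := pgen tt in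
                    exists (sigma' tau' : {rmorphism D -> D}) (j : D -> A),
                      [/\ (forall p, sigma' (pcst p) = pcst (sigma p)) /\
                          sigma' h = pcst q1%:P * h,
                          (forall p, tau' (pcst p) = pcst (tau p)) /\
                          tau' h = pcst (q1^-1)%:P * h,
                          (forall p, j (pcst p) = ev p) /\ j h = x1 * x2
                        & is_gwa sigma' tau' h j x2 x1]],
              regular (x1 * x2) /\ normal_elt (x1 * x2)
            & (* (a) *)
              exists sigma1 : {rmorphism {poly K} -> {poly K}},
                poly_endo sigma1 ('X - alpha%:P) /\
                let D1 := skew_poly sigma1 in
                let y1 : D1 := pgen tt in
                exists (sigma2 : {rmorphism D1 -> D1}) (j : D1 -> A),
                  [/\ forall k : K, sigma2 (pcst k%:P) = pcst k%:P,
                      sigma2 (pcst 'X) = pcst ('X - mu%:P),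
                      sigma2 y1 = pcst q1%:P * y1,
                      (forall p, j (pcst p) = ev p) /\ j y1 = x1
                    & is_skew_poly sigma2 j x2]]]) /\
    (* (b) *)
    swap_iso q1 1 0 q1^-1 0 1 /\
    (* (c) *)
    swap_iso (-1 : K) 1 0 (-1) 0 1) /\
  (* mu + alpha = 0 *)
  (M 2 1 + M 1 0 = 0 ->
    exists alpha c b1 : K,
      [/\ exactly_one (case2a alpha c b1) (case2b alpha c b1)
            (case2c alpha c b1),
          G3_equiv Q M B (nf_Q q1) (nf_M alpha (- alpha) c) (nf_B b1)
        & let A := nf q1 alpha (- alpha) c b1 in
          let x1 : A := nfx q1 alpha (- alpha) c b1 0 in
          let x2 : A := nfx q1 alpha (- alpha) c b1 1 in
          let ev : {poly K} -> A := nf_eval q1 alpha (- alpha) c b1 in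
          (exists sigma tau : {rmorphism {poly K} -> {poly K}},
             [/\ poly_endo sigma ('X + alpha%:P),
                 cancel sigma tau, cancel tau sigma
               & is_diskew sigma tau (c *: 'X + b1%:P) q1%:P ev x2 x1]) /\
          (let D := {poly {poly K}} in
           let x3 : D := 'X%:P in
           let h : D := 'X in
           exists (sigma : {rmorphism D -> D}) (j : D -> A),
             [/\ forall k : K, sigma k%:P%:P = k%:P%:P,
                 sigma x3 = x3 + alpha%:P%:P,
                 sigma h = q1%:P%:P * h + c%:P%:P * x3 + b1%:P%:P,
                 (forall p, j p%:P = ev p) /\ j h = x1 * x2
               & is_classical_gwa sigma h j x2 x1])]) /\
  (* the cases 2(a)-(c) in compact form *)
  (forall alpha c b1 : K,
     [\/ case2a alpha c b1, case2b alpha c b1 | case2c alpha c b1] <->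
     [/\ alpha \in [:: 0; 1], c \in [:: 0; 1] & b1 \in [:: 0; 1]] \/
     [/\ alpha = 1, c = 1 & (b1 != 0) && (b1 != 1)]).
Proof.
move=> q1; have q10 : q1 != 0 by apply: hQ.
split; last split; last by move=> *; apply: case2_compact.
- move=> am0; split; last first.
    by split; apply: nf_swap_iso; rewrite ?mulfV // mulrNN mulr1.
  have [al [mu [hal G]]] := G3_nf_generic hq1 hq2 hq3 hPBW am0.
  exists al, mu; split=> // A x1 x2 ev.
  have [sigma sigmaP] := poly_endoP ('X - mu%:P).
  have [tau tauP] := poly_endoP ('X - al%:P).
  have x1n := algA_x0_normal al mu q10; have x2n := algA_x1_normal al mu q10.
  split=> //; last 1 first.
  + exists tau; split=> //.
    exact: (@nf_skew_poly K q1 al mu 0 0 sigma tau).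
  + exists sigma, tau; split=> //.
    * apply: (@nf_diskew K q1 al mu 0 0 sigma tau); rewrite ?mulr0 //.
      by rewrite scale0r rmorph0 addr0.
    * by rewrite sigmaP.2 rmorphB /= tauP.2 tauP.1.
    * exact: (@nf_skew_gwa K q1 al mu 0 0 sigma tau).
  + exact: regular_normalM.
- move=> am0; have [al [c [b [h G]]]] := G3_nf_classical hq1 hq2 hq3 hPBW am0.
  exists al, c, b; split=> //; first exact: case2_exactly_one.
  move=> A x1 x2 ev; split; last exact: nf_classical_gwa.
  have [sigma sigmaP] := poly_endoP ('X + al%:P).
  have [tau tauP] := poly_endoP ('X - al%:P).
  exists sigma, tau; split=> //.
  + move=> p; rewrite -[LHS]/((tau \o sigma) p) -[RHS]/(idfun p).
    apply: poly_ext => [k|] /=; first by rewrite sigmaP.1 tauP.1.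
    by rewrite sigmaP.2 rmorphD /= tauP.2 tauP.1 subrK.
  + move=> p; rewrite -[LHS]/((sigma \o tau) p) -[RHS]/(idfun p).
    apply: poly_ext => [k|] /=; first by rewrite tauP.1 sigmaP.1.
    by rewrite tauP.2 rmorphB /= sigmaP.2 sigmaP.1 addrK.
  (* Here [mu = - al], so ['X - mu] is ['X + al] and the factor [al + mu] is zero. *)
  + apply: nf_diskew => //; first by rewrite rmorphN opprK.
    by rewrite subrr rmorph0 mul0r.
Qed.
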